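(* Let $n\ge 8.8\times 10^{6}$ and let $G$ be an $n$-vertex graph with \[ \lambda(G)\ge \lambda\big(K_{\lceil \frac{n}{2}\rceil,\lfloor \frac{n}{2}\rfloor}^{+2}\big). \] Then $G$ contains at least $\lfloor \frac{n}{2}\rfloor$ bowties. Moreover, $K_{\lceil \frac{n}{2}\rceil,\lfloor \frac{n}{2}\rfloor}^{+2}$ is the unique extremal graph: up to isomorphism it is the only $n$-vertex graph $G$ satisfying this spectral condition that contains exactly $\lfloor \frac{n}{2}\rfloor$ bowties.
   Context: Graphs are finite, simple and undirected. $\lambda(G)$ denotes the spectral radius of $G$, i.e. the maximum modulus of the eigenvalues of the adjacency matrix of $G$. The bowtie $F_2$ is the graph on $5$ vertices consisting of two triangles sharing exactly one common vertex; the number of bowties in $G$ is the number of (not necessarily induced) subgraphs of $G$ isomorphic to $F_2$. $K_{\lceil n/2\rceil,\lfloor n/2\rfloor}^{+2}$ is the graph obtained from the complete bipartite graph $K_{\lceil n/2\rceil,\lfloor n/2\rfloor}$ by adding two disjoint edges inside the vertex part of size $\lceil n/2\rceil$. *)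

(* Defs.v *)
From HB Require Import structures.
From mathcomp Require Import all_boot all_order all_algebra.
From mathcomp Require Import complex reals.

Set Implicit Arguments.
Unset Strict Implicit.
Unset Printing Implicit Defensive.

Import Order.TTheory GRing.Theory Num.Theory.
Local Open Scope ring_scope.

Record sgraph (T : finType) := SGraph {
  adj :> rel T;
  adj_sym : symmetric adj;
  adj_irr : irreflexive adj }.

Definition edges (T : finType) (G : sgraph T) : {set {set T}} :=
  [set e | [exists x, exists y, adj G x y && (e == [set x; y])]].

Definition isomorphic (T U : finType) (G : sgraph T) (H : sgraph U) : Prop :=
  exists2 f : T -> U, bijective f & forall x y, adj H (f x) (f y) = adj G x y.

(* A subgraph is a pair (vertex set, edge set). *)
Definition is_subgraph (T : finType) (G : sgraph T)
    (H : {set T} * {set {set T}}) : bool :=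
  (H.2 \subset edges G) && [forall e in H.2, e \subset H.1].

Definition is_copy (T U : finType) (F : sgraph U)
    (H : {set T} * {set {set T}}) : bool :=
  [exists f : {ffun U -> T},
    [&& injectiveb f, H.1 == f @: [set: U]
      & H.2 == [set f @: (e : {set U}) | e in edges F]]].

Definition count_copies (T U : finType) (F : sgraph U) (G : sgraph T) : nat :=
  #|[set H : {set T} * {set {set T}} | is_subgraph G H && is_copy F H]|.

Definition joined (s : seq (nat * nat)) (i j : nat) : bool :=
  ((i, j) \in s) || ((j, i) \in s).

(* Vertex 0 is the common vertex of the triangles {0,1,2} and {0,3,4}. *)
Definition bowtie_adj : rel 'I_5 := fun i j =>
  joined [:: (0, 1); (0, 2); (1, 2); (0, 3); (0, 4); (3, 4)]%N i j.

Lemma bowtie_sym : symmetric bowtie_adj.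
Proof. by move=> i j; rewrite /bowtie_adj /joined orbC. Qed.

Lemma bowtie_irr : irreflexive bowtie_adj.
Proof. by move=> [[|[|[|[|[|i]]]]] ?]. Qed.

Definition bowtie : sgraph 'I_5 := SGraph bowtie_sym bowtie_irr.

Definition bowties (T : finType) (G : sgraph T) : nat := count_copies bowtie G.

(* K_{a,b}^{+2}: the two edges added to the part of size a are {0,1} and {2,3};
   when a < 4 not both of them exist. *)
Definition Kplus2_adj (a b : nat) : rel ('I_a + 'I_b) := fun x y =>
  match x, y with
  | inl i, inl j => joined [:: (0, 1); (2, 3)]%N i j
  | inr _, inr _ => false
  | _, _ => true
  end.

Lemma Kplus2_sym a b : symmetric (@Kplus2_adj a b).
Proof. by move=> [i|i] [j|j] //=; rewrite /joined orbC. Qed.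

Lemma Kplus2_irr a b : irreflexive (@Kplus2_adj a b).
Proof. by move=> [[[|[|[|[|i]]]] ?]|]. Qed.

Definition Kplus2 (a b : nat) : sgraph ('I_a + 'I_b)%type :=
  SGraph (@Kplus2_sym a b) (@Kplus2_irr a b).

Definition adjmx (K : nzRingType) (T : finType) (G : sgraph T) : 'M[K]_#|T| :=
  \matrix_(i, j) (adj G (enum_val i) (enum_val j))%:R.

(* The eigenvalues of A, with algebraic multiplicity. *)
Definition eigenvalues (C : closedFieldType) (n : nat) (A : 'M[C]_n) : seq C :=
  sval (closed_field_poly_normal (char_poly A)).

Lemma char_poly_eigenvalues (C : closedFieldType) (n : nat) (A : 'M[C]_n) :
  char_poly A = \prod_(z <- eigenvalues A) ('X - z%:P).
Proof.
rewrite /eigenvalues; case: closed_field_poly_normal => s /= {1}->.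
by rewrite (monicP (char_poly_monic A)) scale1r.
Qed.

Lemma mem_eigenvalues (C : closedFieldType) (n : nat) (A : 'M[C]_n) (z : C) :
  (z \in eigenvalues A) = eigenvalue A z.
Proof.
by rewrite eigenvalue_root_char char_poly_eigenvalues root_prod_XsubC.
Qed.

Definition spectral_radius (R : realType) (T : finType) (G : sgraph T) : R :=
  \big[Num.max/0]_(z <- eigenvalues (adjmx R[i] G)) ComplexField.Normc.normc z.

(* Main.v *)
Require Import Defs.
From HB Require Import structures.
From mathcomp Require Import all_boot all_order all_algebra.
From mathcomp Require Import complex reals.
From mathcomp Require Import zify ring lra.

Import Order.TTheory GRing.Theory Num.Theory.
Local Open Scope ring_scope.

(** The graph K^{+2} enters only through lam^2 >= floor(n^2/4) + 4, where lam is
    its spectral radius; an explicit positive eigenvector gives this bound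
    ([Kplus2_radius]). So let lam be the spectral radius of G, satisfying the same
    inequality, and let G have at most n/2 bowties; the point is that G must then
    be K^{+2}. The moduli x of the entries of a complex eigenvector of maximal
    modulus satisfy lam x <= A x entrywise ([spectral_radius_subharmonic]), and
    this one-sided inequality replaces the Perron eigenvector throughout.

    Scale x to have maximum 1, attained at u. Counting walks of length two from u
    gives lam^2 <= sum_w x_w |N(w) :&: N(u)|. Two disjoint edges in the link of u
    form a bowtie with u, so the link has O(n) edges ([sum_link_degree]). Hence N(u)
    and its complement have sizes close to n/2 and all but O(n) pairs across are
    edges. A vertex with two neighbours on one side and a positive proportion of the
    other side is the centre of quadratically many bowties ([bowties_link]);
    therefore every vertex of degree above 0.45 n has at most one neighbour among
    the typical vertices of one side, and this sorts these vertices into parts A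
    and B ([almost_bipartite], [near_bip]).

    Inside such parts the bowtie count is very restrictive: the edges inside A form
    a matching of at most two edges, likewise for B ([inner_edges]), and an edge
    inside A together with one inside B forces two missing cross pairs
    ([missing_ge2], [missing_ge4]).

    Finally the inequality lam x <= A x is tested against the vector equal to |B|
    on A, to lam on B and to 0 elsewhere ([bipartite_estimate]). It bounds
    (lam^2 - |A||B|) times the sum of x over B by a gain from the inner edges, a
    loss from the missing pairs, and a contribution of the low-degree vertices.
    The latter costs more in |A||B| than it contributes, so there are no low-degree
    vertices ([no_low_degree]). Replacing x by A x, whose entries are bounded below,
    each inner edge is worth about as much as one missing pair costs, and the
    surplus lam^2 - |A||B| >= 4 requires a net gain of two edges: two inner edges on
    the same side, no missing pair, and |A||B| = floor(n^2/4)
    ([extremal_structure]). That graph is K^{+2} on parts A and B; it has |B|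
    bowties, so |B| <= n/2 decides which part is the smaller one. *)

(** * Bowties as labelled tuples *)

Section Bowties.

Context {T : finType}.
Implicit Types (G : sgraph T) (A B C : {set T}) (c a b d e u v w z : T).
Implicit Types (H : {set T} * {set {set T}}).

Lemma set2_eq (p q r s : T) :
  ([set p; q] == [set r; s]) =
  (p == r) && (q == s) || (p == s) && (q == r).
Proof.
apply/eqP/orP => [E|[/andP[/eqP-> /eqP->]|/andP[/eqP-> /eqP->]]] //; last first.
  by rewrite setUC.
have := set21 p q; have := set22 p q; rewrite E !inE.
have := set21 r s; have := set22 r s; rewrite -E !inE.
do 4![case/orP=> /eqP ?]; subst; rewrite !eqxx; auto.
Qed.

(** The subgraph made of the triangles {c, a, b} and {c, d, e}. *)
Definition bow c a b d e : {set T} * {set {set T}} :=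
  ([set c; a; b; d; e],
   [set [set c; a]; [set c; b]; [set a; b];
        [set c; d]; [set c; e]; [set d; e]]).

Definition is_bow G c a b d e :=
  [&& uniq [:: c; a; b; d; e], [&& adj G c a, adj G c b & adj G a b]
    & [&& adj G c d, adj G c e & adj G d e]].

Lemma imset_set2 (U : finType) (f : U -> T) x y :
  f @: [set x; y] = [set f x; f y].
Proof. by rewrite imsetU !imset_set1. Qed.

(** Trades the existentially quantified embedding of the abstract bowtie for five
    named vertices; every later count goes through this form. *)
Lemma copy_bowtieP G H :
  reflect (exists t : T * T * T * T * T,
             let: (c, a, b, d, e) := t in
             is_bow G c a b d e /\ H = bow c a b d e)
          (is_subgraph G H && is_copy bowtie H).
Proof.
pose o k : 'I_5 := inord k.
have oE k (lt_k5 : (k < 5)%N) : o k = Ordinal lt_k5.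
  by apply/val_inj; rewrite /= inordK.
have allT (f : 'I_5 -> T) : f @: [set: 'I_5] = [set f (o 0%N); f (o 1%N); f (o 2%N); f (o 3%N); f (o 4%N)].
  apply/setP => x; apply/imsetP/idP => [[[[|[|[|[|[|i]]]]] lti] _ ->//]|].
  - by rewrite (oE 0%N) !inE (_ : Ordinal lti = Ordinal (isT : 0 < 5)%N) ?eqxx //; apply/val_inj.
  - by rewrite (oE 1%N) !inE (_ : Ordinal lti = Ordinal (isT : 1 < 5)%N) ?eqxx ?orbT //; apply/val_inj.
  - by rewrite (oE 2%N) !inE (_ : Ordinal lti = Ordinal (isT : 2 < 5)%N) ?eqxx ?orbT //; apply/val_inj.
  - by rewrite (oE 3%N) !inE (_ : Ordinal lti = Ordinal (isT : 3 < 5)%N) ?eqxx ?orbT //; apply/val_inj.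
  - by rewrite (oE 4%N) !inE (_ : Ordinal lti = Ordinal (isT : 4 < 5)%N) ?eqxx ?orbT //; apply/val_inj.
  by rewrite !inE => /orP[/orP[/orP[/orP[]|]|]|] /eqP ->; eexists.
have allE (f : 'I_5 -> T) : [set f @: (e : {set 'I_5}) | e in edges bowtie] =
    (bow (f (o 0%N)) (f (o 1%N)) (f (o 2%N)) (f (o 3%N)) (f (o 4%N))).2.
  apply/setP => x; apply/imsetP/idP => [[e]|].
    rewrite inE => /existsP[i /existsP[j /andP[ij /eqP->]]] ->; rewrite imset_set2.
    move: i j ij.
    have main (i j : 'I_5) : joined [:: (0, 1); (0, 2); (1, 2); (0, 3); (0, 4); (3, 4)]%N i j -> (i < j)%N ->
      [set f i; f j] \in (bow (f (o 0%N)) (f (o 1%N)) (f (o 2%N)) (f (o 3%N)) (f (o 4%N))).2.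
      move=> ij ltij.
      have -> : i = o i by rewrite /o inord_val.
      have -> : j = o j by rewrite /o inord_val.
      move: (i : nat) (j : nat) ij ltij => {}i {}j.
      rewrite /joined !inE => /orP[]; do 6?[case/orP]; do ?[move=> /eqP[-> ->]]; rewrite ?eqxx ?orbT //.
    move=> i j ij; have ij' : joined [:: (0, 1); (0, 2); (1, 2); (0, 3); (0, 4); (3, 4)]%N j i.
      by move: ij; rewrite /= /bowtie_adj /joined orbC.
    case: (ltngtP i j) => ltij; first exact: main.
      by rewrite setUC; exact: main.
    by move/val_inj: ltij ij => ->; rewrite (adj_irr bowtie).
  have edge (i j : 'I_5) : bowtie_adj i j -> x = [set f i; f j] ->
      exists2 e : {set 'I_5}, e \in edges bowtie & x = f @: e.
    move=> ij ->; exists [set i; j]; last by rewrite imset_set2.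
    by rewrite inE; apply/existsP; exists i; apply/existsP; exists j; rewrite /= ij eqxx.
  rewrite !inE; do 5?[case/orP]; move/eqP=> xE; (apply: edge; last exact: xE); by rewrite !oE.
apply: (iffP andP) => [[sG /existsP[f /and3P[/injectiveP injf /eqP H1 /eqP H2]]]|].
  exists (f (o 0%N), f (o 1%N), f (o 2%N), f (o 3%N), f (o 4%N)).
  have HE : H = bow (f (o 0%N)) (f (o 1%N)) (f (o 2%N)) (f (o 3%N)) (f (o 4%N)).
    by case: H H1 H2 {sG} => /= _ _ -> ->; rewrite allE allT.
  split=> //.
  have ed i j : [set f i; f j] \in H.2 -> adj G (f i) (f j).
    case/andP: sG => /subsetP sub _ /sub.
    rewrite inE => /existsP[p /existsP[q /andP[pq]]]; rewrite set2_eq.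
    by case/orP=> /andP[/eqP-> /eqP->] //; rewrite adj_sym.
  apply/and3P; split.
  - rewrite (_ : [:: _; _; _; _; _] = map f [:: o 0%N; o 1%N; o 2%N; o 3%N; o 4%N]) //.
    by rewrite map_inj_uniq // !oE.
  - by apply/and3P; split; apply: ed; rewrite HE !inE !eqxx ?orbT.
  - by apply/and3P; split; apply: ed; rewrite HE !inE !eqxx ?orbT.
case=> -[[[[c a] b] d] e] [/and3P[un /and3P[ca cb ab] /and3P[cd ce de]] ->].
split.
  apply/andP; split.
    apply/subsetP => x; rewrite !inE.
    have edge p q : adj G p q -> x = [set p; q] -> [exists y, exists z, adj G y z && (x == [set y; z])].
      by move=> pq ->; apply/existsP; exists p; apply/existsP; exists q; rewrite pq eqxx.
    by do 5?[case/orP]; move/eqP=> xE; (apply: edge; last exact: xE).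
  apply/forallP => x; apply/implyP; rewrite !inE.
  by do 5?[case/orP]; move/eqP=> ->; apply/subsetP => y; rewrite !inE => /orP[]->; rewrite ?orbT.
apply/existsP; exists [ffun i : 'I_5 => nth c [:: c; a; b; d; e] i].
pose f : 'I_5 -> T := fun i => nth c [:: c; a; b; d; e] i.
apply/and3P; split.
- apply/injectiveP => i j; rewrite !ffunE => /eqP; rewrite nth_uniq //.
  by move/eqP/val_inj.
- rewrite (_ : _ @: _ = f @: [set: 'I_5]); last by apply: eq_imset => i; rewrite ffunE.
  by rewrite allT /f /o !inordK.
- apply/eqP; transitivity [set f @: (e : {set 'I_5}) | e in edges bowtie].
    by rewrite allE /f /o !inordK.
  by apply: eq_imset => s; apply: eq_imset => i; rewrite ffunE.
Qed.

Lemma bowties_ge (I : finType) (D : {set I}) G (F : I -> T * T * T * T * T) :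
  (forall i, i \in D -> let: (c, a, b, d, e) := F i in is_bow G c a b d e) ->
  {in D &, injective (fun i => let: (c, a, b, d, e) := F i in bow c a b d e)} ->
  (#|D| <= bowties G)%N.
Proof.
move=> Dbow injF; rewrite -(card_in_imset injF) /bowties /count_copies.
apply/subset_leq_card/subsetP => H /imsetP[i iD ->]; rewrite inE.
apply/copy_bowtieP; exists (F i); move: (Dbow i iD).
by case: (F i) => -[[[c a] b] d] e.
Qed.

End Bowties.

(** * Configurations that contain many bowties *)

Section Families.

Context {T : finType} (G : sgraph T).
Implicit Types (A B C : {set T}) (a b c d e p q r s u v w x y z : T).

Definition nbr v : {set T} := [set w | adj G v w].

Lemma in_nbr v w : (w \in nbr v) = adj G v w.
Proof. by rewrite inE. Qed.

Lemma nbr_sym v w : (w \in nbr v) = (v \in nbr w).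
Proof. by rewrite !inE adj_sym. Qed.

Lemma nbr_irr v : (v \in nbr v) = false.
Proof. by rewrite inE adj_irr. Qed.

(** A vertex [v] with neighbours [w] and [z] that both see many vertices of [C]
    inside the neighbourhood of [v] is the centre of the bowties with triangles
    [v w b1] and [v z b2]. The vertex set forgets which of [b1], [b2] belongs to
    [w], so injectivity is read off the edge sets. *)
Lemma bowties_link v w z C k :
  w \in nbr v -> z \in nbr v -> w != z ->
  C \subset nbr v -> w \notin C -> z \notin C ->
  (k <= #|C :&: nbr w|)%N -> (k <= #|C :&: nbr z|)%N ->
  (k * k.-1 <= bowties G)%N.
Proof.
move=> vw vz wz /subsetP Cv wC zC kw kz.
set X := C :&: nbr w in kw; set Y := C :&: nbr z in kz.
pose D := setX X Y :\: [set (b, b) | b in X].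
have leD : (k * k.-1 <= #|D|)%N.
  have le1 : (#|X| * #|Y| - #|X| <= #|D|)%N.
    rewrite cardsD cardsX leq_sub2l //.
    by rewrite (leq_trans (subset_leq_card (subsetIr _ _))) // leq_imset_card.
  apply: leq_trans le1; rewrite -{2}(muln1 #|X|) -mulnBr subn1.
  by rewrite leq_mul // -!subn1 leq_sub2r.
apply: leq_trans leD _.
have DP b1 b2 : (b1, b2) \in D ->
    [/\ b1 \in C, adj G w b1, b2 \in C, adj G z b2 & b1 != b2].
  rewrite inE in_setX /X /Y !in_setI !in_nbr /= => /andP[nd].
  case/andP=> /andP[b1C wb1] /andP[b2C zb2]; split=> //.
  apply: contraNneq nd => <-; apply/imsetP; exists b1 => //.
  by rewrite inE b1C in_nbr wb1.
have ne p q : adj G p q -> p != q by apply: contraTneq => ->; rewrite adj_irr.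
apply: (@bowties_ge _ _ D G (fun t => (v, w, t.1, z, t.2))) => [[b1 b2]|[b1 b2] [b3 b4]].
  case/DP=> b1C wb1 b2C zb2 ne12.
  have := Cv _ b1C; have := Cv _ b2C; rewrite !inE => vb2 vb1.
  move: vw vz; rewrite !inE => vw vz.
  rewrite /is_bow vw vz wb1 zb2 vb1 vb2 /= !inE !negb_or !andbT.
  rewrite (ne _ _ vw) (ne _ _ vb1) (ne _ _ vz) (ne _ _ vb2) (ne _ _ wb1) (ne _ _ zb2).
  rewrite wz ne12 /=.
  have -> : w != b2 by apply: contraNneq wC => ->.
  by have -> : b1 != z by apply: contraNneq zC => <-.
case/DP=> b1C wb1 b2C zb2 ne12; case/DP=> b3C wb3 b4C zb4 ne34.
move=> [_ E].
have neC x y : x \in C -> y \notin C -> (y == x) = false.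
  by move=> xC yC; apply: contraNF yC => /eqP->.
have vC : v \notin C by apply/negP => /Cv; rewrite inE adj_irr.
have nvw : (w == v) = false by apply: contraTF vw => /eqP->; rewrite inE adj_irr.
have nvz : (z == v) = false by apply: contraTF vz => /eqP->; rewrite inE adj_irr.
have : [set w; b1] \in (bow v w b1 z b2).2 by rewrite !inE eqxx ?orbT.
have : [set z; b2] \in (bow v w b1 z b2).2 by rewrite !inE eqxx ?orbT.
rewrite /= E !inE !set2_eq !eqxx nvw nvz (negbTE wz) (eq_sym z w) (negbTE wz).
rewrite !(neC b3 z, neC b3 w, neC b4 z, neC b4 w) // (eq_sym b1 v) (eq_sym b2 v).
rewrite !(neC b1 v, neC b2 v) //= ?andbF ?orbF /=.
by move=> /eqP-> /eqP->.
Qed.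

(** A disjoint union that indexes two families of bowties at once. *)
Definition sum_set A B : {set T + T} := inl @: A :|: inr @: B.

Lemma in_sum_setl A B v : (inl v \in sum_set A B) = (v \in A).
Proof.
rewrite inE mem_imset; last by move=> ? ? [].
by case: imsetP => [[]//|_]; rewrite orbF.
Qed.

Lemma in_sum_setr A B v : (inr v \in sum_set A B) = (v \in B).
Proof.
rewrite inE orbC mem_imset; last by move=> ? ? [].
by case: imsetP => [[]//|_]; rewrite orbF.
Qed.

Lemma card_sum_set A B : #|sum_set A B| = (#|A| + #|B|)%N.
Proof.
rewrite cardsU !card_imset; try by move=> ? ? [].
rewrite (_ : _ :&: _ = set0) ?cards0 ?subn0 //.
by apply/setP => x; rewrite !inE; apply/andP => -[/imsetP[y _ ->] /imsetP[]].
Qed.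

Lemma bowties_two_edges v1 w1 v2 w2 C :
  w1 \in nbr v1 -> w2 \in nbr v2 -> uniq [:: v1; w1; v2; w2] ->
  C \subset nbr v1 :&: nbr w1 :&: (nbr v2 :&: nbr w2) ->
  (#|C| <= bowties G)%N.
Proof.
rewrite !inE => e1 e2 un /subsetP sC.
apply: (@bowties_ge _ _ C G (fun k => (k, v1, w1, v2, w2))) => [k kC|k k' kC k'C].
  have := sC k kC; rewrite !inE !(adj_sym G _ k) => /andP[/andP[a1 a2] /andP[a3 a4]].
  rewrite /is_bow a1 a2 a3 a4 e1 e2 /= !andbT.
  have ne p q : adj G p q -> p != q by apply: contraTneq => ->; rewrite adj_irr.
  move: un; rewrite /= !inE !negb_or => /and4P[-> -> -> _].
  by rewrite (ne _ _ a1) (ne _ _ a2) (ne _ _ a3) (ne _ _ a4).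
case=> E _; have : k \in [set k; v1; w1; v2; w2] by rewrite !inE eqxx.
rewrite E !inE => /orP[/orP[/orP[/orP[/eqP//|]|]|]|] /eqP eqk;
  by have := sC k kC; rewrite !inE eqk !adj_irr ?andbF.
Qed.

(** The bowties through the first two edges and those through the first and the
    third are told apart by [v2], hence the condition that [v2] is not a centre. *)
Lemma bowties_three_edges v1 w1 v2 w2 v3 w3 C C' :
  w1 \in nbr v1 -> w2 \in nbr v2 -> w3 \in nbr v3 ->
  uniq [:: v1; w1; v2; w2; v3; w3] ->
  C \subset nbr v1 :&: nbr w1 :&: (nbr v2 :&: nbr w2) ->
  C' \subset nbr v1 :&: nbr w1 :&: (nbr v3 :&: nbr w3) ->
  v2 \notin C' ->
  (#|C| + #|C'| <= bowties G)%N.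
Proof.
rewrite !inE => e1 e2 e3 un /subsetP sC /subsetP sC' v2C'.
pose D := sum_set C C'.
have cD : #|D| = (#|C| + #|C'|)%N by exact: card_sum_set.
have iL k : (inl k \in D) = (k \in C) by exact: in_sum_setl.
have iR k : (inr k \in D) = (k \in C') by exact: in_sum_setr.
have cK k : k \in C -> [/\ adj G k v1, adj G k w1, adj G k v2 & adj G k w2].
  by move/sC; rewrite !inE !(adj_sym G _ k) => /andP[/andP[-> ->] /andP[-> ->]].
have cK' k : k \in C' -> [/\ adj G k v1, adj G k w1, adj G k v3 & adj G k w3].
  by move/sC'; rewrite !inE !(adj_sym G _ k) => /andP[/andP[-> ->] /andP[-> ->]].
have ne p q : adj G p q -> p != q by apply: contraTneq => ->; rewrite adj_irr.
have /and5P[] := un; rewrite !inE !negb_or.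
case/and5P=> n1 n2 n3 n4 n5 /and4P[m1 m2 m3 m4] /and3P[l1 l2 l3] _ _.
rewrite -cD; apply: (@bowties_ge _ _ D G (fun k => match k with
   inl k => (k, v1, w1, v2, w2) | inr k => (k, v1, w1, v3, w3) end)).
  move=> [k|k]; rewrite ?iL ?iR => /[dup] kC; [case/cK|case/cK'] => a1 a2 a3 a4;
  rewrite /is_bow a1 a2 a3 a4 ?e1 ?e2 ?e3 /= ?andbT;
  by rewrite !inE !negb_or (ne _ _ a1) (ne _ _ a2) (ne _ _ a3) (ne _ _ a4)
    ?n1 ?n2 ?n3 ?n4 ?n5 ?m1 ?m2 ?m3 ?m4 ?l1 ?(ne _ _ e3).
have cross k k' : k \in C -> k' \in C' ->
    [set k; v1; w1; v2; w2] = [set k'; v1; w1; v3; w3] -> False.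
  move=> kC k'C E; have : v2 \in [set k; v1; w1; v2; w2] by rewrite !inE eqxx ?orbT.
  rewrite E !inE (negbTE l2) (negbTE l3) (eq_sym v2 v1) (eq_sym v2 w1).
  by rewrite (negbTE n2) (negbTE m1) !orbF => /eqP ek; move: v2C'; rewrite ek k'C.
move=> [k|k] [k'|k']; rewrite ?iL ?iR => kC k'C [E _].
- have : k \in [set k; v1; w1; v2; w2] by rewrite !inE eqxx.
  have [a1 a2 a3 a4] := cK _ kC.
  by rewrite E !inE (negbTE (ne _ _ a1)) (negbTE (ne _ _ a2))
    (negbTE (ne _ _ a3)) (negbTE (ne _ _ a4)) !orbF => /eqP->.
- by case: (cross k k').
- by case: (cross k' k).
- have : k \in [set k; v1; w1; v3; w3] by rewrite !inE eqxx.
  have [a1 a2 a3 a4] := cK' _ kC.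
  by rewrite E !inE (negbTE (ne _ _ a1)) (negbTE (ne _ _ a2))
    (negbTE (ne _ _ a3)) (negbTE (ne _ _ a4)) !orbF => /eqP->.
Qed.

(** An edge [v w] and an edge [y z] with at most the pair [w z] missing between
    them: [v] is the centre of the triangles [v y z] and [v w k], and [y] that of
    [y v w] and [y z k]. *)
Lemma bowties_cross_edges v w y z C C' :
  w \in nbr v -> z \in nbr y -> y \in nbr v -> z \in nbr v -> w \in nbr y ->
  w != z ->
  C \subset nbr v :&: nbr w -> C' \subset nbr y :&: nbr z ->
  y \notin C -> z \notin C -> v \notin C' -> w \notin C' -> [disjoint C & C'] ->
  (#|C| + #|C'| <= bowties G)%N.
Proof.
rewrite !inE => vw yz vy vz yw wz /subsetP sC /subsetP sC' yC zC vC' wC' dis.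
pose D := sum_set C C'.
have cD : #|D| = (#|C| + #|C'|)%N by exact: card_sum_set.
have iL k : (inl k \in D) = (k \in C) by exact: in_sum_setl.
have iR k : (inr k \in D) = (k \in C') by exact: in_sum_setr.
have cK k : k \in C -> [/\ adj G v k, adj G w k, k != y & k != z].
  move=> kC; have := sC _ kC; rewrite !inE => /andP[-> ->].
  by split=> //; [apply: contraNneq yC => <- | apply: contraNneq zC => <-].
have cK' k : k \in C' -> [/\ adj G y k, adj G z k, k != v & k != w].
  move=> kC; have := sC' _ kC; rewrite !inE => /andP[-> ->].
  by split=> //; [apply: contraNneq vC' => <- | apply: contraNneq wC' => <-].
have ne p q : adj G p q -> p != q by apply: contraTneq => ->; rewrite adj_irr.
have sym p q : adj G p q -> adj G q p by rewrite adj_sym.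
rewrite -cD; apply: (@bowties_ge _ _ D G (fun k => match k with
   inl k => (v, y, z, w, k) | inr k => (y, v, w, z, k) end)).
  move=> [k|k]; rewrite ?iL ?iR => /[dup] kC; [case/cK|case/cK'] => a1 a2 a3 a4.
    rewrite /is_bow a1 a2 vw yz vy vz /= !andbT !inE !negb_or.
    rewrite (ne _ _ vw) (ne _ _ yz) (ne _ _ vy) (ne _ _ vz) (ne _ _ yw) (ne _ _ a1).
    rewrite (ne _ _ a2) (eq_sym y k) (eq_sym z k) a3 a4 /= andbT.
    by rewrite (eq_sym z w) wz.
  rewrite /is_bow a1 a2 vw yz yw (sym _ _ vy) /= !andbT !inE !negb_or.
  rewrite (ne _ _ vw) (ne _ _ yz) (ne _ _ (sym _ _ vy)) (ne _ _ yw) (ne _ _ a1) (ne _ _ a2).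
  have -> : v != z by exact: ne.
  rewrite wz.
  by rewrite (eq_sym v k) (eq_sym w k) a3 a4.
have own v' y' z' w' k k' : k != v' -> k != y' -> k != z' -> k != w' ->
    k \in [set v'; y'; z'; w'; k'] -> k = k'.
  by rewrite !inE => /negbTE-> /negbTE-> /negbTE-> /negbTE-> /eqP.
have last5 v' y' z' w' k : k \in [set v'; y'; z'; w'; k] by rewrite !inE eqxx orbT.
move=> [k|k] [k'|k']; rewrite ?iL ?iR => kC k'C [E _].
- have := last5 v y z w k; rewrite E => kE.
  have [a1 a2 a3 a4] := cK _ kC; congr inl; apply: (own v y z w) => //; exact/ne/sym.
- have := last5 v y z w k; rewrite E => kE.
  have [a1 a2 a3 a4] := cK _ kC.
  have ek : k = k' by apply: (own y v w z) => //; exact/ne/sym.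
  by move: (disjointFr dis kC); rewrite ek k'C.
- have := last5 v y z w k'; rewrite -E => kE.
  have [a1 a2 a3 a4] := cK _ k'C.
  have ek : k' = k by apply: (own y v w z) => //; exact/ne/sym.
  by move: (disjointFr dis k'C); rewrite ek kC.
- have := last5 y v w z k; rewrite E => kE.
  have [a1 a2 a3 a4] := cK' _ kC; congr inr; apply: (own y v w z) => //; exact/ne/sym.
Qed.

(** Once an edge [p q] of the link of [u] is fixed, every link edge disjoint from
    it completes a bowtie centred at [u], and at most [4 * #|T|] ordered pairs
    meet [p q]. *)
Lemma sum_link_degree u :
  (\sum_(w in nbr u) #|nbr w :&: nbr u| <= 4 * #|T| + 2 * bowties G)%N.
Proof.
pose E := [set t : T * T | [&& t.1 \in nbr u, t.2 \in nbr u & t.2 \in nbr t.1]].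
have -> : (\sum_(w in nbr u) #|nbr w :&: nbr u| = #|E|)%N.
  rewrite -sum1_card (partition_big fst (mem (nbr u))) /=; last first.
    by move=> [r s]; rewrite inE => /and3P[].
  apply: eq_bigr => w uw; rewrite -sum1_card.
  rewrite (reindex_onto (fun s => (w, s)) snd) /=; last first.
    by move=> [r s] /andP[_ /eqP/= ->].
  by apply: eq_bigl => s; move: uw; rewrite !inE /= !eqxx !andbT => ->; rewrite /= [RHS]andbC.
have [->|[[p q]]] := set_0Vmem E; first by rewrite cards0.
rewrite inE /= => /and3P[up uq pq].
pose D := [set t in E | (t.1 \notin [set p; q]) && (t.2 \notin [set p; q])].
(* Ordering by rank keeps one of the two orientations of each link edge. *)
pose D1 := [set t in D | (enum_rank t.1 < enum_rank t.2)%N].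
pose S (r : T) := [set (r, s) | s in [set: T]] :|: [set (s, r) | s in [set: T]].
have ne r s : adj G r s -> r != s by apply: contraTneq => ->; rewrite adj_irr.
have DP r s : (r, s) \in D -> [/\ adj G u r, adj G u s, adj G r s,
    (r != p) && (r != q) & (s != p) && (s != q)].
  by rewrite !inE /= !negb_or => /andP[/and3P[-> -> ->] /andP[-> ->]].
have sub : E \subset S p :|: S q :|: (D1 :|: [set (t.2, t.1) | t in D1]).
  apply/subsetP => -[r s] rsE; rewrite 2!in_setU.
  have [rsD|] := boolP ((r, s) \in D).
    apply/orP; right; rewrite inE.
    have [_ _ /ne rs _ _] := DP _ _ rsD.
    case: (ltngtP (enum_rank r) (enum_rank s)) => lt.
    - by apply/orP; left; rewrite inE rsD.
    - apply/orP; right; apply/imsetP; exists (s, r) => //.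
      rewrite inE lt andbT; move: rsD; rewrite !inE /= => /andP[/and3P[-> -> rs1] /andP[-> ->]].
      by rewrite adj_sym rs1.
    - by move/val_inj/enum_rank_inj: lt rs => ->; rewrite eqxx.
  rewrite inE rsE /= negb_and !negbK !inE => h.
  apply/orP; left.
  have Sl x y : (x, y) \in S x.
    by rewrite inE; apply/orP; left; apply/imsetP; exists y.
  have Sr x y : (y, x) \in S x.
    by rewrite inE; apply/orP; right; apply/imsetP; exists y.
  move: (Sl r s) (Sr s r); rewrite !inE => h1 h2.
  case/orP: h => /orP[] /eqP e; rewrite -e ?h1 ?h2 ?orbT //.
apply: leq_trans (subset_leq_card sub) _.
have cS r : (#|S r| <= 2 * #|T|)%N.
  rewrite (leq_trans (leq_card_setU _ _)) // mul2n -addnn -cardsT.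
  by rewrite leq_add // leq_imset_card.
have cD1 : (#|D1| <= bowties G)%N.
  apply: (@bowties_ge _ _ D1 G (fun t => (u, p, q, t.1, t.2))) => [[r s]|[r s] [r' s']].
    rewrite inE => /andP[/DP[ur us rs /andP[rp rq] /andP[sp sq]] _] /=.
    move: up uq pq; rewrite !in_nbr => up uq pq.
    rewrite /is_bow ur us rs up uq pq /= !inE !negb_or !andbT.
    rewrite (ne _ _ up) (ne _ _ uq) (ne _ _ ur) (ne _ _ us) (ne _ _ pq) (ne _ _ rs).
    by rewrite !(eq_sym p) !(eq_sym q) rp rq sp sq.
  rewrite inE => /andP[/DP[ur us _ /andP[/negbTE rp /negbTE rq] /andP[/negbTE sp /negbTE sq]] lt].
  rewrite inE => /andP[/DP[_ _ _ _ _] lt'] [E' _]; rewrite /= in lt lt' E'.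
  have nru : (r == u) = false by rewrite eq_sym; exact/negbTE/ne.
  have nsu : (s == u) = false by rewrite eq_sym; exact/negbTE/ne.
  have : r \in [set u; p; q; r; s] by rewrite !inE eqxx ?orbT.
  have : s \in [set u; p; q; r; s] by rewrite !inE eqxx ?orbT.
  rewrite E' !inE rp rq sp sq nru nsu /= => /orP[]/eqP es /orP[]/eqP er.
  - by move: lt; rewrite er es ltnn.
  - by move: lt; rewrite er es ltnNge (ltnW lt').
  - by rewrite er es.
  - by move: lt; rewrite er es ltnn.
have cD1' : (#|[set (t.2, t.1) | t in D1]| <= #|D1|)%N by exact: leq_imset_card.
apply: leq_trans (leq_card_setU _ _) _.
apply: leq_trans (leq_add (leq_card_setU _ _) (leq_card_setU _ _)) _.
apply: leq_trans (leq_add (leq_add (cS p) (cS q)) (leq_add cD1 (leq_trans cD1' cD1))) _.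
by rewrite -mulnDl (mul2n (bowties G)) -addnn.
Qed.

End Families.

(** * The graph K^{+2}: bowties and recognition *)

Lemma count_copies_le (W T U : finType) (F : sgraph W) (G : sgraph T)
    (H : sgraph U) (f : T -> U) :
  injective f -> (forall x y, adj G x y -> adj H (f x) (f y)) ->
  (count_copies F G <= count_copies F H)%N.
Proof.
move=> injf homf.
pose phi (X : {set T} * {set {set T}}) :=
  (f @: X.1, (fun e : {set T} => f @: e) @: X.2).
have injphi : injective phi.
  move=> [X1 X2] [Y1 Y2] [] /(imset_inj injf) ->.
  by move=> /(imset_inj (imset_inj injf)) ->.
rewrite /count_copies -(card_imset _ injphi).
apply/subset_leq_card/subsetP => _ /imsetP[[V E] + ->]; rewrite inE => /andP[].
case/andP=> /subsetP sub /forallP incid /existsP[g /and3P[/injectiveP injg /eqP VE /eqP EE]].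
rewrite inE; apply/andP; split.
  apply/andP; split.
    apply/subsetP => _ /imsetP[e /sub eG ->]; move: eG.
    rewrite inE => /existsP[x /existsP[y /andP[xy /eqP ->]]]; rewrite inE.
    apply/existsP; exists (f x); apply/existsP; exists (f y).
    by rewrite homf //= imset_set2.
  apply/forallP => e'; apply/implyP => /imsetP[e eE ->].
  by apply: imsetS; move: (incid e); rewrite eE.
rewrite /= in VE EE; apply/existsP; exists [ffun i => f (g i)]; apply/and3P; split.
- by apply/injectiveP => i j; rewrite !ffunE => /injf/injg.
- rewrite /= VE -imset_comp; apply/eqP; apply: eq_imset => i /=.
  by rewrite ffunE.
- rewrite /= EE -imset_comp; apply/eqP; apply: eq_imset => e /=.
  by rewrite -imset_comp; apply: eq_imset => i; rewrite ffunE.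
Qed.

Lemma count_copies_iso (W T U : finType) (F : sgraph W) (G : sgraph T)
    (H : sgraph U) :
  isomorphic G H -> count_copies F G = count_copies F H.
Proof.
case=> f [g gK fK] fE; apply/eqP; rewrite eqn_leq; apply/andP; split.
  by apply: (@count_copies_le _ _ _ F G H f) => [|x y]; [exact: can_inj gK | rewrite fE].
apply: (@count_copies_le _ _ _ F H G g) => [|x y]; first exact: can_inj fK.
by rewrite -{1}(fK x) -{1}(fK y) fE.
Qed.

Section BowSym.
Context {T : finType}.
Implicit Types c a b d e : T.

Lemma bow_swap1 c a b d e : bow c a b d e = bow c b a d e.
Proof.
rewrite /bow (setUC [set b] [set a]); congr pair.
  by apply/setP => x; rewrite !inE; do 5!case: (x == _).
by apply/setP => x; rewrite !inE; do 6!case: (x == _).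
Qed.

Lemma bow_swap c a b d e : bow c a b d e = bow c d e a b.
Proof.
rewrite /bow; congr pair.
  by apply/setP => x; rewrite !inE; do 5!case: (x == _).
by apply/setP => x; rewrite !inE; do 6!case: (x == _).
Qed.

Lemma bow_swap2 c a b d e : bow c a b d e = bow c a b e d.
Proof. by rewrite bow_swap bow_swap1 bow_swap. Qed.
End BowSym.

Section Kplus2.
Context (a b : nat).
Hypothesis a_ge4 : (4 <= a)%N.

Let i0 : 'I_a := Ordinal (leq_trans (isT : 0 < 4)%N a_ge4).
Let i1 : 'I_a := Ordinal (leq_trans (isT : 1 < 4)%N a_ge4).
Let i2 : 'I_a := Ordinal (leq_trans (isT : 2 < 4)%N a_ge4).
Let i3 : 'I_a := Ordinal (leq_trans (isT : 3 < 4)%N a_ge4).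

Lemma joinedP (i j : 'I_a) : joined [:: (0, 1); (2, 3)]%N i j ->
  [\/ i = i0 /\ j = i1, i = i1 /\ j = i0, i = i2 /\ j = i3 | i = i3 /\ j = i2].
Proof.
rewrite /joined !inE => /orP[] /orP[] /eqP [ei ej].
- by apply: Or41; split; apply/val_inj.
- by apply: Or43; split; apply/val_inj.
- by apply: Or42; split; apply/val_inj.
- by apply: Or44; split; apply/val_inj.
Qed.

Lemma joined_uniq (i j k : 'I_a) : joined [:: (0, 1); (2, 3)]%N i j ->
  joined [:: (0, 1); (2, 3)]%N i k -> j = k.
Proof. by case/joinedP=> -[-> ->] /joinedP[] [] // [] ? ->. Qed.

Lemma joined_lt (i j : 'I_a) : joined [:: (0, 1); (2, 3)]%N i j -> (i < 4)%N /\ (j < 4)%N.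
Proof. by case/joinedP=> -[-> ->]. Qed.

Lemma joined_partner (i : 'I_a) : (i < 4)%N ->
  exists j : 'I_a, joined [:: (0, 1); (2, 3)]%N i j.
Proof.
by case: i => [[|[|[|[|m]]]] lt] //= _; [exists i1|exists i0|exists i3|exists i2].
Qed.

(** A triangle of K^{+2} consists of one of the two added edges and a vertex of the
    other part. As the added edges are disjoint, two triangles that share exactly
    one vertex share the latter. *)
Lemma bowties_Kplus2_le : (bowties (Kplus2 a b) <= b)%N.
Proof.
pose canon (c : 'I_b) := bow (inr c : 'I_a + 'I_b) (inl i0) (inl i1) (inl i2) (inl i3).
have leb : (#|canon @: [set: 'I_b]| <= b)%N.
  by rewrite (leq_trans (leq_imset_card _ _)) // cardsT card_ord.
apply: leq_trans leb.
apply/subset_leq_card/subsetP => H; rewrite inE => /copy_bowtieP[[[[[c x] y] z] t]].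
case=> /and3P[un /and3P[cx cy xy] /and3P[cz ct zt]] ->.
have tri (i : 'I_a) p q : adj (Kplus2 a b) (inl i) p -> adj (Kplus2 a b) (inl i) q ->
    adj (Kplus2 a b) p q ->
    exists2 j : 'I_a, joined [:: (0, 1); (2, 3)]%N i j & p = inl j \/ q = inl j.
  case: p => [j|j] /=; first by move=> ij _ _; exists j; auto.
  by case: q => [k|k] //= _ ik _; exists k; auto.
case: c un cx cy cz ct => [i|c] un cx cy cz ct.
  have [j ij Hj] := tri _ _ _ cx cy xy; have [k ik Hk] := tri _ _ _ cz ct zt.
  move: un; rewrite -(joined_uniq _ _ _ ij ik) in Hk.
  by case: Hj => ->; case: Hk => -> /=; rewrite !inE !eqxx ?orbT /= ?andbF.
case: x y z t un cx cy xy cz ct zt => [x|//] [y|//] [z|//] [t|//] un _ _ xy _ _ zt.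
apply/imsetP; exists c; rewrite // /canon; move: un; rewrite /=.
case: (joinedP _ _ xy) => -[-> ->]; case: (joinedP _ _ zt) => -[-> ->] //;
 rewrite !inE ?eqxx ?orbT ?andbF //= => _.
- by rewrite bow_swap2.
- by rewrite bow_swap1.
- by rewrite bow_swap1 bow_swap2.
- by rewrite bow_swap.
- by rewrite bow_swap bow_swap1.
- by rewrite bow_swap bow_swap2.
- by rewrite bow_swap bow_swap1 bow_swap2.
Qed.

Lemma bowties_Kplus2 : bowties (Kplus2 a b) = b.
Proof.
apply/eqP; rewrite eqn_leq bowties_Kplus2_le /=.
pose C : {set 'I_a + 'I_b} := inr @: [set: 'I_b].
have cC : #|C| = b by rewrite card_imset ?cardsT ?card_ord // => ? ? [].
rewrite -[X in (X <= _)%N]cC.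
apply: (bowties_two_edges (Kplus2 a b) (inl i0) (inl i1) (inl i2) (inl i3) C) => //.
- by rewrite in_nbr.
- by rewrite in_nbr.
by apply/subsetP => _ /imsetP[c _ ->]; rewrite !inE.
Qed.

End Kplus2.

Lemma isomorphic_Kplus2 (T : finType) (G : sgraph T) (A B : {set T}) v1 w1 v2 w2 :
  ~: A = B -> uniq [:: v1; w1; v2; w2] -> {subset [:: v1; w1; v2; w2] <= A} ->
  {in A & B, forall x y, adj G x y} ->
  {in B &, forall x y, ~~ adj G x y} ->
  {in A &, forall x y, adj G x y = ([set x; y] \in [:: [set v1; w1]; [set v2; w2]])} ->
  isomorphic G (Kplus2 #|A| #|B|).
Proof.
move=> AB un sub4 AdjAB AdjB AdjA.
(* Listing [A] from these four vertices on sends the two edges to {0,1} and {2,3}. *)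
pose s := [:: v1; w1; v2; w2] ++ filter [predC [:: v1; w1; v2; w2]] (enum A).
have us : uniq s.
  rewrite cat_uniq un filter_uniq ?enum_uniq // andbT /=.
  by apply/hasPn => x; rewrite mem_filter => /andP[].
have ms : s =i A.
  move=> x; rewrite mem_cat mem_filter mem_enum.
  have [/sub4-> //|/= /negbTE xn] := boolP (x \in [:: v1; w1; v2; w2]).
  by rewrite xn.
have ss : size s = #|A| by rewrite -(card_uniqP us); apply: eq_card.
have lts x : x \in A -> (index x s < #|A|)%N by rewrite -ss index_mem ms.
have xB x : x \in A = false -> x \in enum B by rewrite mem_enum -AB inE => ->.
have ltB x : x \in A = false -> (index x (enum B) < #|B|)%N.
  by move=> xA; rewrite cardE index_mem xB.
have v1A : v1 \in A by apply: sub4; rewrite inE eqxx.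
pose f x : 'I_#|A| + 'I_#|B| :=
  if insub (index x s) is Some i then inl i
  else if insub (index x (enum B)) is Some j then inr j
  else inl (Ordinal (lts v1 v1A)).
have fA x (h : x \in A) : f x = inl (Ordinal (lts x h)).
  by rewrite /f insubT ?lts // => lt; congr inl; apply/val_inj.
have fB x (h : x \in A = false) : f x = inr (Ordinal (ltB x h)).
  rewrite /f insubF; last by rewrite -ss index_mem ms.
  by rewrite insubT ?ltB // => lt; congr inr; apply/val_inj.
have injf : injective f.
  move=> x y; have [xA|/negbTE xA] := boolP (x \in A); have [yA|/negbTE yA] := boolP (y \in A).
  - by rewrite (fA _ xA) (fA _ yA) => -[E]; rewrite -[x](nth_index v1 (s := s)) ?ms // -[y](nth_index v1 (s := s)) ?ms // [index x s]E.
  - by rewrite (fA _ xA) (fB _ yA).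
  - by rewrite (fB _ xA) (fA _ yA).
  - by rewrite (fB _ xA) (fB _ yA) => -[E]; rewrite -[x](nth_index v1 (s := enum B)) ?xB // E nth_index ?xB.
exists f.
  apply: inj_card_bij => //; rewrite card_sum !card_ord.
  by rewrite -AB -[leqRHS](cardsC A).
have joinE x y (xA : x \in A) (yA : y \in A) :
    joined [:: (0, 1); (2, 3)]%N (index x s) (index y s) = adj G x y.
  rewrite AdjA //.
  have idx z k : z \in A -> (k < 4)%N -> (index z s == k) = (z == nth v1 s k).
    move=> zA ltk; have ltks : (k < size s)%N by rewrite size_cat (leq_trans ltk) ?leq_addr.
    apply/eqP/eqP => [<-|->]; first by rewrite nth_index ?ms.
    by rewrite index_uniq.
  rewrite /joined !inE !xpair_eqE !idx //= !set2_eq.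
  by rewrite -!orbA; do 8!case: (_ == _).
move=> x y; have [xA|/negbTE xA] := boolP (x \in A); have [yA|/negbTE yA] := boolP (y \in A).
- by rewrite (fA _ xA) (fA _ yA) /= joinE.
- by rewrite (fA _ xA) (fB _ yA) /= AdjAB // -AB inE yA.
- by rewrite (fB _ xA) (fA _ yA) /= adj_sym AdjAB // -AB inE xA.
- by rewrite (fB _ xA) (fB _ yA) /=; apply/esym/negbTE/AdjB; rewrite -AB inE ?xA ?yA.
Qed.

(** * The spectral radius *)

Section Spectral.
Context {R : realType} {T : finType} (G : sgraph T).

Notation normc := ComplexField.Normc.normc.

Lemma normc_ge0 (z : R[i]) : 0 <= normc z.
Proof. by case: z => a b; rewrite /= sqrtr_ge0. Qed.

Lemma normc_sum (I : finType) (P : pred I) (F : I -> R[i]) :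
  normc (\sum_(i | P i) F i) <= \sum_(i | P i) normc (F i).
Proof.
elim/big_ind2: _ => [|x y z t hx hz|//]; first by rewrite ComplexField.Normc.normc0.
by rewrite (le_trans (le_normcD _ _)) ?lerD.
Qed.

Lemma adjmx_mulE (w : 'rV[R[i]]_#|T|) (v : T) :
  (w *m adjmx R[i] G) 0 (enum_rank v) = \sum_(u in nbr G v) w 0 (enum_rank u).
Proof.
rewrite mxE (reindex_onto (@enum_rank T) enum_val) => [|i _]; last exact: enum_valK.
rewrite (eq_bigl predT) => [|u]; last by rewrite enum_rankK eqxx.
rewrite [RHS]big_mkcond; apply: eq_bigr => u _.
by rewrite mxE !enum_rankK in_nbr adj_sym; case: adj; rewrite ?mulr1 ?mulr0.
Qed.

(** Taking moduli in the eigenvector equation for an eigenvalue of maximal modulus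
    and applying the triangle inequality. *)
Lemma spectral_radius_subharmonic :
  0 < spectral_radius R G ->
  exists x : T -> R, [/\ forall v, 0 <= x v, exists v, 0 < x v &
    forall v, spectral_radius R G * x v <= \sum_(w in nbr G v) x w].
Proof.
rewrite /spectral_radius; set s := eigenvalues _.
set r := \big[_/_]_(_ <- _) _ => r_gt0.
have [z zs rz] : exists2 z, z \in s & r = normc z.
  have : r = 0 \/ exists2 z, z \in s & r = normc z.
    rewrite /r big_seq; elim/big_ind: _ => [|x y hx hy|z zs]; [by left| |by right; exists z].
    by rewrite /Num.max; case: ifP.
  by case=> // r0; rewrite r0 ltxx in r_gt0.
move: zs; rewrite /s mem_eigenvalues => /eigenvalueP[w wA w0].
exists (fun v => normc (w 0 (enum_rank v))); split=> [v||v]; first exact: normc_ge0.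
  have [j wj] : exists j, w 0 j != 0.
    apply/existsP; apply: contraNT w0; rewrite negb_exists => /forallP h.
    by apply/eqP/rowP => j; rewrite mxE; have := h j; rewrite negbK => /eqP.
  exists (enum_val j); rewrite enum_valK lt_neqAle normc_ge0 andbT eq_sym.
  by apply: contra wj => /eqP/ComplexField.Normc.eq0_normc->.
rewrite rz -ComplexField.Normc.normcM.
have -> : z * w 0 (enum_rank v) = (w *m adjmx R[i] G) 0 (enum_rank v) by rewrite wA mxE.
by rewrite adjmx_mulE normc_sum.
Qed.

Lemma spectral_radius_ge (x : T -> R) (mu : R) :
  0 <= mu -> (exists v, x v != 0) ->
  (forall v, \sum_(w in nbr G v) x w = mu * x v) -> mu <= spectral_radius R G.
Proof.
move=> mu0 [v0 xv0] xE.
have mev : mu%:C%C \in eigenvalues (adjmx R[i] G).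
  rewrite mem_eigenvalues; apply/eigenvalueP.
  exists (\row_j (x (enum_val j))%:C%C).
    apply/rowP => j; rewrite -(enum_valK j) adjmx_mulE !mxE enum_rankK -rmorphM -xE rmorph_sum.
    by apply: eq_bigr => u _; rewrite mxE enum_rankK.
  apply: contra xv0 => /eqP/rowP/(_ (enum_rank v0)); rewrite !mxE enum_rankK.
  by case=> ->.
have -> : mu = normc mu%:C%C by rewrite /= expr0n /= addr0 sqrtr_sqr ger0_norm.
exact: le_bigmax_seq.
Qed.

End Spectral.

Lemma sum_first4 (R : pzRingType) (a : nat) (p q : R) : (4 <= a)%N ->
  \sum_(i < a) (if (i < 4)%N then p else q) = 4 * p + (a%:R - 4) * q.
Proof.
move=> a4; rewrite -(big_mkord predT (fun i => if (i < 4)%N then p else q)).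
rewrite (big_cat_nat_idem _ _ a4) //=; last by rewrite addr0.
congr (_ + _).
  rewrite (eq_big_nat _ _ (F2 := fun=> p)) => [|i /andP[_ ->]//].
  by rewrite sumr_const_nat mulr_natl.
rewrite (eq_big_nat _ _ (F2 := fun=> q)) => [|i /andP[le4 _]]; last by rewrite ltnNge le4.
by rewrite sumr_const_nat -natrB // mulr_natl.
Qed.

(** The vector equal to [mu b] on the ends of the added edges, [(mu - 1) b] on the
    rest of the first part and [mu (mu - 1)] on the second part is an eigenvector
    as soon as [(mu^2 - a b) (mu - 1) = 4 b]. For such a [mu], either
    [mu - 1 <= b], whence [mu^2 - a b >= 4], or [mu > b + 1], whence
    [mu^2 > b^2 + 2 b + 1 >= a b + 4]. *)
Lemma Kplus2_radius (R : realType) (a b : nat) :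
  (4 <= a)%N -> (3 <= b)%N -> (a <= b.+1)%N -> 
  0 < spectral_radius R (Kplus2 a b) /\
  (a * b)%:R + 4 <= spectral_radius R (Kplus2 a b) ^+ 2.
Proof.
move=> a4 b3 ab.
have a4R : (4 : R) <= a%:R by rewrite (ler_nat R 4).
have b3R : (3 : R) <= b%:R by rewrite (ler_nat R 3).
have abR : a%:R <= b%:R + 1 :> R by rewrite natr1 ler_nat.
have [mu mu1 muE] : exists2 mu : R, 1 < mu & (mu ^+ 2 - (a * b)%:R) * (mu - 1) = 4 * b%:R.
  pose p : {poly R} := ('X ^+ 2 - (a * b)%:R%:P) * ('X - 1) - (4 * b%:R)%:P.
  have pE y : p.[y] = (y ^+ 2 - (a * b)%:R) * (y - 1) - 4 * b%:R.
    by rewrite /p !hornerE.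
  have [| |y /andP[y1 _] /rootP py] := @poly_ivt R p 1 (a%:R + b%:R + 1).
    by rewrite lerDr addr_ge0.
    rewrite !pE natrM; apply/andP; split; nra.
  exists y; last by move: py; rewrite pE => /eqP; rewrite subr_eq0 => /eqP.
  rewrite lt_neqAle y1 andbT; apply: contra_eq_neq py => <-.
  by rewrite pE subrr mulr0 sub0r oppr_eq0 mulf_neq0 ?pnatr_eq0 //; lia.
have mu0 : 0 < mu by lra.
have mu_le : mu <= spectral_radius R (Kplus2 a b).
  pose x (v : 'I_a + 'I_b) : R :=
    match v with inl i => if (i < 4)%N then mu * b%:R else (mu - 1) * b%:R
    | inr _ => mu * (mu - 1) end.
  apply: (spectral_radius_ge _ x) => [||v]; first exact: ltW.
    exists (inr (Ordinal (leq_trans (isT : 0 < 3)%N b3))) => /=.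
    by rewrite mulf_neq0 ?subr_eq0 ?gt_eqF.
  rewrite big_sumType /=.
  have e2 : mu * mu * (mu - 1) = b%:R * (a%:R * mu - a%:R + 4).
    move: muE; rewrite natrM => muE; lra.
  case: v => [i|j].
    have -> : \sum_(k : 'I_b | inr k \in nbr (Kplus2 a b) (inl i)) mu * (mu - 1) = b%:R * (mu * (mu - 1)).
      rewrite (eq_bigl predT) => [|k]; last by rewrite in_nbr.
      by rewrite sumr_const card_ord mulr_natl.
    case: (boolP (i < 4)%N) => i4.
      have [k ik] := joined_partner _ a4 _ i4.
      rewrite (big_pred1 k) => [|k']; last first.
        rewrite in_nbr /=; apply/idP/eqP => [ik'|->//].
        exact: (joined_uniq _ a4 _ _ _ ik' ik).
      have [_ ->] := joined_lt _ a4 _ _ ik; rewrite /x i4; ring.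
    rewrite /x (negbTE i4) big_pred0 => [|k]; first by ring.
    rewrite in_nbr /=; apply/negP => ik.
    by have [] := joined_lt _ a4 _ _ ik; rewrite (negbTE i4).
  rewrite [X in _ + X]big_pred0 => [|k]; last by rewrite in_nbr.
  rewrite (eq_bigl predT) => [|k]; last by rewrite in_nbr.
  rewrite sum_first4 // /x; lra.
split; first exact: lt_le_trans mu_le.
apply: le_trans (_ : mu ^+ 2 <= _); last by rewrite ler_sqr ?nnegrE // ?ltW // (lt_le_trans mu0).
rewrite natrM in muE *.
case: (lerP mu (b%:R + 1)) => hmu; last nra.
nra.
Qed.

(** * Few bowties in an almost complete bipartite graph *)

Section Near.
Context {T : finType} (G : sgraph T).
Implicit Types (A B C : {set T}) (u v w x y z : T).
Local Notation n := #|T|.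
Local Notation N := (nbr G).
Hypothesis n_big : (88 * 10 ^ 5 <= n)%N.
Hypothesis few : (2 * bowties G <= n)%N.

Lemma cards_meet A B C : A \subset C -> B \subset C ->
  (#|A| + #|B| <= #|C| + #|A :&: B|)%N.
Proof.
move=> AC BC; rewrite -cardsUI leq_add2r subset_leq_card //.
by rewrite subUset AC.
Qed.

Lemma few_bowties_link v w z C :
  w \in N v -> z \in N v -> w != z ->
  C \subset N v -> w \notin C -> z \notin C ->
  (n <= 1000 * #|C :&: N w|)%N -> (n <= 1000 * #|C :&: N z|)%N -> False.
Proof.
move=> vw vz wz Cv wC zC cw cz.
pose k := minn #|C :&: N w| #|C :&: N z|.
have le_b := bowties_link G v w z C k vw vz wz Cv wC zC (geq_minl _ _) (geq_minr _ _).
(* [k >= n / 1000 > 4000], so [k (k - 1)] exceeds [n / 2]. *)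
have kn : (n <= 1000 * k)%N by rewrite /k; lia.
have k1 : (4000 <= k.-1)%N by lia.
have : (k * 4000 <= bowties G)%N by rewrite (leq_trans _ le_b) // leq_mul2l k1 orbT.
clear le_b; lia.
Qed.

(** The vertices of low degree lie outside both parts. The constants leave room for
    four vertices of one part to have more than [n / 4] common neighbours in the
    other one ([common4]). *)
Record near_bip A B : Prop := NearBip {
  nb_dis : [disjoint A & B];
  nb_A : (498 * n <= 1000 * #|A| <= 502 * n)%N;
  nb_B : (498 * n <= 1000 * #|B| <= 502 * n)%N;
  nb_AB : forall v, v \in A -> (449 * n <= 1000 * #|N v :&: B|)%N;
  nb_BA : forall v, v \in B -> (449 * n <= 1000 * #|N v :&: A|)%N }.

Lemma near_bip_sym A B : near_bip A B -> near_bip B A.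
Proof. by case=> h1 h2 h3 h4 h5; split; rewrite // disjoint_sym. Qed.

Section Inner.
Context {A B : {set T}}.
Hypothesis AB : near_bip A B.

Lemma nb_notin v : v \in A -> v \in B = false.
Proof. by move=> vA; rewrite (disjointFr (nb_dis _ _ AB) vA). Qed.

Lemma common2 v w : v \in A -> w \in A ->
  (396 * n <= 1000 * #|N v :&: N w :&: B|)%N.
Proof.
move=> vA wA; have := cards_meet (N v :&: B) (N w :&: B) B (subsetIr _ _) (subsetIr _ _).
rewrite setIACA setIid.
have := nb_AB _ _ AB v vA; have := nb_AB _ _ AB w wA; have := nb_B _ _ AB; lia.
Qed.

Lemma common4 v w x y : v \in A -> w \in A -> x \in A -> y \in A ->
  (290 * n <= 1000 * #|N v :&: N w :&: (N x :&: N y) :&: B|)%N.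
Proof.
move=> vA wA xA yA.
have := cards_meet (N v :&: N w :&: B) (N x :&: N y :&: B) B (subsetIr _ _) (subsetIr _ _).
rewrite setIACA setIid.
have := common2 v w vA wA; have := common2 x y xA yA; have := nb_B _ _ AB; lia.
Qed.

Lemma inner_deg v : v \in A -> (#|N v :&: A| <= 1)%N.
Proof.
move=> vA; rewrite leqNgt; apply/negP => /card_gt1P[w [z [wI zI wz]]].
move: wI zI; rewrite !(in_setI, in_nbr) => /andP[vw wA] /andP[vz zA].
apply: (few_bowties_link v w z (N v :&: B)); rewrite ?in_nbr ?inE ?subsetIl ?(nb_notin w) ?(nb_notin z) ?andbF //.
  by rewrite setIAC; have := common2 v w vA wA; lia.
by rewrite setIAC; have := common2 v z vA zA; lia.
Qed.

Lemma inner_uniq v w z : v \in A -> w \in A -> z \in A -> adj G v w -> adj G v z -> w = z.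
Proof.
move=> vA wA zA vw vz; apply/eqP/negPn/negP => wz.
have : (1 < #|N v :&: A|)%N.
  by apply/card_gt1P; exists w, z; rewrite !(in_setI, in_nbr) vw vz wA zA.
by rewrite ltnNge inner_deg.
Qed.

(** Each of the two pairs used has at least [0.29 n] centres on the other side, and
    [0.58 n] exceeds the allowed number of bowties. *)
Lemma no_three_edges v1 w1 v2 w2 v3 w3 : {subset [:: v1; w1; v2; w2; v3; w3] <= A} ->
  uniq [:: v1; w1; v2; w2; v3; w3] ->
  adj G v1 w1 -> adj G v2 w2 -> adj G v3 w3 -> False.
Proof.
move=> sub un e1 e2 e3.
have inA x : x \in [:: v1; w1; v2; w2; v3; w3] -> x \in A by exact: sub.
have [v1A w1A v2A] : [/\ v1 \in A, w1 \in A & v2 \in A] by split; apply: inA; rewrite !inE eqxx ?orbT.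
have [w2A v3A w3A] : [/\ w2 \in A, v3 \in A & w3 \in A] by split; apply: inA; rewrite !inE eqxx ?orbT.
have := bowties_three_edges G v1 w1 v2 w2 v3 w3
  (N v1 :&: N w1 :&: (N v2 :&: N w2) :&: B) (N v1 :&: N w1 :&: (N v3 :&: N w3) :&: B).
rewrite !in_nbr => /(_ e1 e2 e3 un (subsetIl _ _) (subsetIl _ _)).
rewrite !in_setI (nb_notin v2) // !andbF => /(_ isT).
have := common4 v1 w1 v2 w2 v1A w1A v2A w2A.
have := common4 v1 w1 v3 w3 v1A w1A v3A w3A.
lia.
Qed.

(** Twice the number of edges inside [X]. *)
Definition inner (X : {set T}) := (\sum_(v in X) #|N v :&: X|)%N.

(** The edges inside a part form a matching ([inner_uniq]) without three edges, so a
    value of [inner] above 2 determines all edges inside the part. *)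
Lemma inner_edges : (inner A <= 2)%N \/
  (inner A <= 4)%N /\ exists v1 w1 v2 w2, [/\ {subset [:: v1; w1; v2; w2] <= A},
    uniq [:: v1; w1; v2; w2], adj G v1 w1, adj G v2 w2 &
    {in A &, forall x y, adj G x y = ([set x; y] \in [:: [set v1; w1]; [set v2; w2]])}].
Proof.
pose S := [set v in A | N v :&: A != set0].
have SP v : v \in S -> v \in A /\ exists2 w, w \in A & adj G v w.
  rewrite inE => /andP[vA /set0Pn[w]]; rewrite in_setI in_nbr => /andP[vw wA].
  by split=> //; exists w.
have PS : inner A = #|S|.
  rewrite -sum1_card /inner big_mkcond [RHS]big_mkcond; apply: eq_bigr => v _.
  rewrite !inE; case: ifPn => //= vA; have := inner_deg v vA.
  by rewrite -cards_eq0; case: #|_| => [|[]].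
rewrite PS; case: (leqP #|S| 2) => cS; [by left|right].
have pick2 v w : exists2 x, x \in S & x \notin [set v; w].
  have : (0 < #|S :\: [set v; w]|)%N.
    rewrite cardsD subn_gt0 (leq_ltn_trans _ cS) // (leq_trans (subset_leq_card (subsetIr _ _))) //.
    by rewrite cards2; case: (v != w).
  by case/card_gt0P=> x; rewrite in_setD => /andP[xn xS]; exists x.
have [v1 v1S] : exists v1, v1 \in S by apply/card_gt0P; lia.
have [v1A [w1 w1A e1]] := SP _ v1S.
have [v2 v2S] := pick2 v1 w1; rewrite !inE negb_or => /andP[n21 n21'].
have [v2A [w2 w2A e2]] := SP _ v2S.
have ne p q : adj G p q -> p != q by apply: contraTneq => ->; rewrite adj_irr.
have sym p q : adj G p q -> adj G q p by rewrite adj_sym.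
have nw21 : w2 != v1.
  by apply: contraNneq n21' => E; apply/eqP/(inner_uniq v1); rewrite // sym // -E.
have nw21' : w2 != w1.
  by apply: contraNneq n21 => E; apply/eqP/(inner_uniq w1); rewrite // sym // -E.
have un : uniq [:: v1; w1; v2; w2].
  rewrite /= !inE !negb_or (ne _ _ e1) (ne _ _ e2) (eq_sym v1 v2) (eq_sym w1 v2) n21 n21'.
  by rewrite (eq_sym v1 w2) (eq_sym w1 w2) nw21 nw21'.
have sub : {subset [:: v1; w1; v2; w2] <= A}.
  by move=> x; rewrite !inE => /or4P[]/eqP->.
have in4 x y : x \in A -> y \in A -> adj G x y -> x \in [:: v1; w1; v2; w2].
  move=> xA yA xy; apply/negPn/negP => xn.
  have yn : y \notin [:: v1; w1; v2; w2].
    apply: contra xn; rewrite !inE => /or4P[]/eqP E; subst y.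
    - by rewrite (inner_uniq v1 x w1) ?eqxx ?orbT // sym.
    - by rewrite (inner_uniq w1 x v1) ?eqxx ?orbT // sym.
    - by rewrite (inner_uniq v2 x w2) ?eqxx ?orbT // sym.
    - by rewrite (inner_uniq w2 x v2) ?eqxx ?orbT // sym.
  apply: (no_three_edges v1 w1 v2 w2 x y) => //.
    by move=> t; rewrite (mem_cat t [:: v1; w1; v2; w2] [:: x; y]) => /orP[/sub//|]; rewrite !inE => /orP[]/eqP->.
  rewrite (cat_uniq [:: v1; w1; v2; w2] [:: x; y]) un andTb; apply/andP; split.
    by apply/hasPn => t; rewrite 2!inE => /orP[]/eqP->.
  by rewrite /= inE (ne _ _ xy).
split.
  have sS : S \subset [set x in [:: v1; w1; v2; w2]].
    by apply/subsetP => x /SP[xA [y yA xy]]; rewrite inE; exact: (in4 x y).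
  by rewrite (leq_trans (subset_leq_card sS)) // cardsE (leq_trans (card_size _)).
exists v1, w1, v2, w2; split=> // x y xA yA.
apply/idP/idP => [xy|]; rewrite !inE !set2_eq; last first.
  by case/orP=> /orP[]/andP[/eqP-> /eqP->] //; exact: sym.
have := in4 x y xA yA xy; rewrite !inE => /or4P[]/eqP E; subst x.
- by rewrite (inner_uniq v1 y w1) // !eqxx.
- by rewrite (inner_uniq w1 y v1 w1A yA v1A xy (sym _ _ e1)) !eqxx ?orbT.
- by rewrite (inner_uniq v2 y w2) // !eqxx ?orbT.
- by rewrite (inner_uniq w2 y v2 w2A yA v2A xy (sym _ _ e2)) !eqxx ?orbT.
Qed.

Lemma inner_edge : (0 < inner A)%N -> exists v w, [/\ v \in A, w \in A & adj G v w].
Proof.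
rewrite lt0n sum_nat_eq0 negb_forall => /existsP[v]; rewrite negb_imply => /andP[vA].
by rewrite cards_eq0 => /set0Pn[w]; rewrite in_setI in_nbr => /andP[vw wA]; exists v, w.
Qed.

End Inner.

Definition missing A B : {set T * T} := [set p in setX A B | ~~ adj G p.1 p.2].

Section Cross.
Context {A B : {set T}}.
Hypothesis AB : near_bip A B.
Let BA := near_bip_sym _ _ AB.

Lemma no_cross_edges v w y z : v \in A -> w \in A -> y \in B -> z \in B ->
  adj G v w -> adj G y z -> adj G v y -> adj G v z -> adj G y w -> False.
Proof.
move=> vA wA yB zB vw yz vy vz yw.
pose C := N v :&: N w :&: B :\: [set y; z]; pose C' := N y :&: N z :&: A :\: [set v; w].
have cC : (396 * n <= 1000 * (#|C| + 2))%N.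
  have := common2 AB v w vA wA; have := cardsD (N v :&: N w :&: B) [set y; z].
  have := subset_leq_card (subsetIr (N v :&: N w :&: B) [set y; z]).
  rewrite -/C; have : (#|[set y; z]| <= 2)%N by rewrite cards2; case: (_ != _).
  lia.
have cC' : (396 * n <= 1000 * (#|C'| + 2))%N.
  have := common2 BA y z yB zB; have := cardsD (N y :&: N z :&: A) [set v; w].
  have := subset_leq_card (subsetIr (N y :&: N z :&: A) [set v; w]).
  rewrite -/C'; have : (#|[set v; w]| <= 2)%N by rewrite cards2; case: (_ != _).
  lia.
suff : (#|C| + #|C'| <= bowties G)%N by lia.
apply: (bowties_cross_edges G v w y z); rewrite ?in_nbr //.
- by apply: contraTneq wA => ->; rewrite (nb_notin BA).
- by apply/subsetP => x; rewrite in_setD in_setI => /andP[_ /andP[]].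
- by apply/subsetP => x; rewrite in_setD in_setI => /andP[_ /andP[]].
- by rewrite in_setD !inE eqxx.
- by rewrite in_setD !inE eqxx orbT.
- by rewrite in_setD !inE eqxx.
- by rewrite in_setD !inE eqxx orbT.
- rewrite -setI_eq0; apply/eqP/setP => x; rewrite in_set0 !(in_setI, in_setD).
  by case: (boolP (x \in A)) => [/(nb_notin AB)->|]; rewrite ?andbF.
Qed.

Lemma missing_ge (s : seq (T * T)) : uniq s -> (count [in missing A B] s <= #|missing A B|)%N.
Proof.
move=> us; rewrite -size_filter cardE uniq_leq_size ?filter_uniq //.
by move=> x; rewrite mem_filter mem_enum => /andP[].
Qed.

Let square v w y z := [:: (v, y); (v, z); (w, y); (w, z)].

(** If at most one of the four pairs is missing, each of the two edges has an end
    joined to both ends of the other one, which [no_cross_edges] excludes. *)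
Lemma square_missing v w y z : v \in A -> w \in A -> y \in B -> z \in B ->
  adj G v w -> adj G y z -> (2 <= count [in missing A B] (square v w y z))%N.
Proof.
move=> vA wA yB zB vw yz.
rewrite /= !inE /= vA wA yB zB /=.
have := no_cross_edges v w y z; have := no_cross_edges v w z y.
have := no_cross_edges w v y z; have := no_cross_edges w v z y.
rewrite !(adj_sym G y v) !(adj_sym G z v) !(adj_sym G y w) !(adj_sym G z w) !(adj_sym G w v) !(adj_sym G z y).
rewrite vA wA yB zB vw yz.
move=> h1 h2 h3 h4; move: (h1 isT isT isT isT isT isT) (h2 isT isT isT isT isT isT)
  (h3 isT isT isT isT isT isT) (h4 isT isT isT isT isT isT).
case: (adj G v y); case: (adj G v z); case: (adj G w y); case: (adj G w z) => //= k1 k2 k3 k4; exfalso; auto.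
Qed.

Lemma missing_ge2 : (0 < inner A)%N -> (0 < inner B)%N -> (2 <= #|missing A B|)%N.
Proof.
move=> /inner_edge[v [w [vA wA vw]]] /inner_edge[y [z [yB zB yz]]].
apply: leq_trans (square_missing v w y z vA wA yB zB vw yz) _; apply: missing_ge.
have ne p q : adj G p q -> p != q by apply: contraTneq => ->; rewrite adj_irr.
by rewrite /= !inE !xpair_eqE !eqxx (negbTE (ne _ _ vw)) (negbTE (ne _ _ yz)) /= ?andbF.
Qed.

Lemma missing_ge4 : (2 < inner A)%N -> (0 < inner B)%N -> (4 <= #|missing A B|)%N.
Proof.
have [le2|[_ [v1 [w1 [v2 [w2 [sub un e1 e2 _]]]]]]] := inner_edges AB; first by rewrite ltnNge le2.
move=> _ /inner_edge[y [z [yB zB yz]]].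
have inA x : x \in [:: v1; w1; v2; w2] -> x \in A by exact: sub.
have [v1A w1A] : v1 \in A /\ w1 \in A by split; apply: inA; rewrite !inE eqxx ?orbT.
have [v2A w2A] : v2 \in A /\ w2 \in A by split; apply: inA; rewrite !inE eqxx ?orbT.
have := leq_add (square_missing v1 w1 y z v1A w1A yB zB e1 yz) (square_missing v2 w2 y z v2A w2A yB zB e2 yz).
rewrite -count_cat => /leq_trans; apply; apply: missing_ge.
have ne p q : adj G p q -> p != q by apply: contraTneq => ->; rewrite adj_irr.
move: un; rewrite /= !inE !negb_or => /and4P[/and3P[n1 n2 n3] /andP[n4 n5] n6 _].
rewrite !xpair_eqE !eqxx (negbTE n1) (negbTE n2) (negbTE n3) (negbTE n4) (negbTE n5) (negbTE n6).
by rewrite (negbTE (ne _ _ yz)) /= ?andbF.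
Qed.

End Cross.
End Near.

(** * From an almost complete cut to two parts *)

Lemma balanced_parts (a d n : nat) : (88 * 10 ^ 5 <= n)%N -> (a + d = n)%N -> (a <= d)%N ->
  (n * n <= 4 * (a * d) + 20 * n)%N -> (499 * n <= 1000 * a)%N.
Proof.
move=> n_big ad /subnKC; move: (d - a)%N => e dE leab.
have e2 : (e * e <= 20 * n)%N.
  have E : (n * n = 4 * (a * d) + e * e)%N by rewrite -ad -dE; ring.
  lia.
(* Otherwise [e^2 <= 20 n < 10^4 e], so [e < 10^4] and [n < 500 e < 5 * 10^6]. *)
have : (500 * e <= n)%N; last by lia.
rewrite leqNgt; apply/negP => h.
have : (e * e < 100 * 100 * e)%N by lia.
by rewrite ltn_mul2r => /andP[_ ?]; lia.
Qed.

Section Coarse.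
Context {T : finType} (G : sgraph T).
Implicit Types (A B C X Y : {set T}) (u v w x y z : T).
Local Notation n := #|T|.
Local Notation N := (nbr G).
Hypothesis n_big : (88 * 10 ^ 5 <= n)%N.
Hypothesis few : (2 * bowties G <= n)%N.

Lemma sum_card_nbr X Y :
  (\sum_(v in X) #|N v :&: Y| = \sum_(v in Y) #|N v :&: X|)%N.
Proof.
transitivity (\sum_(v in X) \sum_(w in Y) (adj G v w : nat))%N.
  apply: eq_bigr => v _; rewrite -sum1_card big_mkcond [RHS]big_mkcond.
  by apply: eq_bigr => w _; rewrite in_setI in_nbr andbC; case: (w \in Y); case: adj.
rewrite exchange_big; apply: eq_bigr => w _.
rewrite -sum1_card big_mkcond [RHS]big_mkcond.
by apply: eq_bigr => v _; rewrite in_setI in_nbr andbC adj_sym; case: (v \in X); case: adj.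
Qed.

Lemma sum_card_nonnbr X Y :
  (\sum_(v in X) #|Y :\: N v| + \sum_(v in X) #|N v :&: Y| = #|X| * #|Y|)%N.
Proof.
rewrite -big_split /= -sum_nat_const; apply: eq_bigr => v _.
by rewrite addnC setIC cardsID.
Qed.

Lemma card_large_le X (f : T -> nat) : (\sum_(w in X) f w <= 5 * n)%N ->
  (#|[set w in X | (n < 100 * f w)%N]| <= 500)%N.
Proof.
move=> le; have n0 : (0 < n)%N by lia.
rewrite -(leq_pmul2r n0) -sum_nat_const.
apply: leq_trans (_ : 100 * (\sum_(w in X) f w) <= _)%N; last by lia.
rewrite big_distrr /= [leqRHS](big_setID [set w in X | (n < 100 * f w)%N]) /=.
rewrite -[leqLHS]addn0 leq_add //.
rewrite (setIidPr _); last by apply/subsetP => w; rewrite inE => /andP[].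
by apply: leq_sum => w; rewrite inE => /andP[_ /ltnW].
Qed.

(** Otherwise two neighbours of [v] in [A0] would both see [n / 100] vertices of
    the link, against [few_bowties_link]. *)
Lemma link_sparse (A0 B0 B : {set T}) v : [disjoint A0 & B0] -> B0 \subset B ->
  (forall w, w \in A0 -> (100 * #|B :\: N w| <= n)%N) ->
  (2 <= #|N v :&: A0|)%N -> (1000 * #|N v :&: B0| < 20 * n)%N.
Proof.
move=> dis B0B gd /card_gt1P[w [z [wI zI wz]]]; rewrite ltnNge; apply/negP => ge.
move: wI zI; rewrite !(in_setI, in_nbr) => /andP[vw wA] /andP[vz zA].
have le (t : T) : t \in A0 -> (n <= 1000 * #|N v :&: B0 :&: N t|)%N.
  move=> tA; have := cardsID (N t) (N v :&: B0); have := gd t tA.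
  have : (#|N v :&: B0 :\: N t| <= #|B :\: N t|)%N.
    by rewrite subset_leq_card // setSD // (subset_trans _ B0B) // subsetIr.
  lia.
apply: (few_bowties_link G n_big few v w z (N v :&: B0)); rewrite ?in_nbr ?subsetIl ?le //.
  by rewrite in_setI (disjointFr dis wA) andbF.
by rewrite in_setI (disjointFr dis zA) andbF.
Qed.

(** At most [5 n] cross pairs are missing, so at most 500 vertices on each side miss
    more than [n / 100] of the other side. By [link_sparse] a vertex with two
    neighbours among the remaining [A0] sees few of [B0] and conversely; a vertex of
    degree above [0.45 n] must therefore see most of one side and at most one vertex
    of the other. It joins the side it does not see, whichever side of the cut it
    was on. *)
Lemma almost_bipartite A B : ~: A = B ->
  (n * n <= 4 * (\sum_(w in A) #|N w :&: B|) + 20 * n)%N ->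
  exists A1 B1, [/\ near_bip G A1 B1,
    (#|A :\: A1| <= 500)%N, (#|B :\: B1| <= 500)%N, (#|~: (A1 :|: B1)| <= 1000)%N &
    forall v, v \in ~: (A1 :|: B1) -> (100 * #|N v| <= 45 * n)%N].
Proof.
move=> AB leE.
have cAB : (#|A| + #|B| = n)%N by rewrite -AB cardsC.
have disAB : [disjoint A & B] by rewrite -AB disjoints_subset setCK.
have mis := sum_card_nonnbr A B.
have mis' := sum_card_nonnbr B A; rewrite sum_card_nbr in mis'.
have le4 : (4 * (#|A| * #|B|) <= n * n)%N by rewrite mulnn -cAB nat_AGM2.
have misA : (\sum_(v in A) #|B :\: N v| <= 5 * n)%N by lia.
have misB : (\sum_(v in B) #|A :\: N v| <= 5 * n)%N.
  by rewrite mulnC in mis'; lia.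
have sizes : (499 * n <= 1000 * #|A| <= 501 * n)%N.
  have leab : (n * n <= 4 * (#|A| * #|B|) + 20 * n)%N by lia.
  case: (leqP #|A| #|B|) => le.
    by have := balanced_parts _ _ _ n_big cAB le leab; lia.
  rewrite (mulnC #|A|) in leab; rewrite addnC in cAB.
  by have := balanced_parts _ _ _ n_big cAB (ltnW le) leab; lia.
pose badA := [set w in A | (n < 100 * #|B :\: N w|)%N].
pose badB := [set w in B | (n < 100 * #|A :\: N w|)%N].
have cbA : (#|badA| <= 500)%N by exact: (card_large_le A (fun w => #|B :\: N w|)).
have cbB : (#|badB| <= 500)%N by exact: (card_large_le B (fun w => #|A :\: N w|)).
pose A0 := A :\: badA; pose B0 := B :\: badB.
clear mis mis' le4 misA misB leE.
have sA0 : A0 \subset A by exact: subsetDl.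
have sB0 : B0 \subset B by exact: subsetDl.
have cA0 : (#|A| <= #|A0| + 500)%N.
  by rewrite -(cardsID badA A) addnC leq_add2l (leq_trans _ cbA) // subset_leq_card // subsetIr.
have cB0 : (#|B| <= #|B0| + 500)%N.
  by rewrite -(cardsID badB B) addnC leq_add2l (leq_trans _ cbB) // subset_leq_card // subsetIr.
have gA w : w \in A0 -> (100 * #|B :\: N w| <= n)%N.
  by rewrite !inE negb_and -leqNgt => /andP[/orP[/negbTE->//|]].
have gB w : w \in B0 -> (100 * #|A :\: N w| <= n)%N.
  by rewrite in_setD [w \in badB]inE negb_and -leqNgt => /andP[/orP[/negbTE->//|]].
have dis0 : [disjoint A0 & B0] by exact: disjointW disAB.
have cL0 : (#|~: (A0 :|: B0)| <= 1000)%N.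
  have := cardsC (A0 :|: B0); have := cardsUI A0 B0.
  rewrite (disjoint_setI0 dis0) cards0; lia.
have spA v : (2 <= #|N v :&: A0|)%N -> (1000 * #|N v :&: B0| < 20 * n)%N.
  exact: link_sparse gA.
have spB v : (2 <= #|N v :&: B0|)%N -> (1000 * #|N v :&: A0| < 20 * n)%N.
  by apply: link_sparse gB => //; rewrite disjoint_sym.
have degE v : (#|N v| <= #|N v :&: A0| + #|N v :&: B0| + 1000)%N.
  rewrite -(cardsID (A0 :|: B0) (N v)) leq_add //.
    by rewrite setIUr cardsU leq_subr.
  by rewrite (leq_trans _ cL0) // subset_leq_card // setDE subsetIr.
pose A1 := [set v | (45 * n < 100 * #|N v|)%N && (#|N v :&: A0| <= 1)%N].
pose B1 := [set v | (45 * n < 100 * #|N v|)%N && (2 <= #|N v :&: A0|)%N].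
have deg_lo v X : (#|N v :&: X| <= #|N v|)%N by rewrite subset_leq_card // subsetIl.
have toB0 v : (#|N v :&: B| <= #|N v :&: B0| + 500)%N.
  apply: leq_trans (leq_add (leqnn _) cbB); apply: leq_trans (leq_card_setU _ _).
  by apply/subset_leq_card/subsetP => z; rewrite !inE; case: (G v z); case: (z \in B) => //=; case: (_ < _)%N.
have toA0 v : (#|N v :&: A| <= #|N v :&: A0| + 500)%N.
  apply: leq_trans (leq_add (leqnn _) cbA); apply: leq_trans (leq_card_setU _ _).
  by apply/subset_leq_card/subsetP => z; rewrite !inE; case: (G v z); case: (z \in A) => //=; case: (_ < _)%N.
have A01 : A0 \subset A1.
  apply/subsetP => w wA; rewrite inE; have := gA w wA; have := cardsID (N w) B.
  rewrite setIC => e1 e2; have := toB0 w; have := deg_lo w B => e3 e4.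
  have big : (2000 * n <= 5000 * #|N w :&: B0|)%N.
    by move: n_big cAB sizes e1 e2 e4; clear; lia.
  apply/andP; split; first by move: n_big cAB sizes e1 e2 e3; clear; lia.
  by rewrite leqNgt; apply/negP => /spA; move: n_big big; clear; lia.
have B01 : B0 \subset B1.
  apply/subsetP => w wB; rewrite inE; have := gB w wB; have := cardsID (N w) A.
  rewrite setIC => e1 e2; have := toA0 w; have := deg_lo w A => e3 e4.
  apply/andP; split; first by move: n_big cAB sizes e1 e2 e3; clear; lia.
  by move: n_big cAB sizes e1 e2 e4; clear; lia.
have dis1 : [disjoint A1 & B1].
  rewrite disjoints_subset; apply/subsetP => v; rewrite !inE => /andP[_].
  by rewrite negb_and leqNgt => ->; rewrite orbT.
have cA1 := subset_leq_card A01; have cB1 := subset_leq_card B01.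
have c1 : (#|A1| + #|B1| <= n)%N.
  by rewrite -cardsUI (disjoint_setI0 dis1) cards0 addn0 max_card.
have loA v : (#|N v :&: A0| <= #|N v :&: A1|)%N by rewrite subset_leq_card // setIS.
have loB v : (#|N v :&: B0| <= #|N v :&: B1|)%N by rewrite subset_leq_card // setIS.
have nbr_B0 v : v \in A1 -> (449 * n <= 1000 * #|N v :&: B0|)%N.
  by rewrite inE => /andP[h1 h2]; have := degE v; move: n_big h1 h2; clear; lia.
have nbr_A0 v : v \in B1 -> (449 * n <= 1000 * #|N v :&: A0|)%N.
  rewrite inE => /andP[h1 /spA h2]; have h3 := degE v.
  case: (leqP 2 #|N v :&: B0|) => [/spB h4|h4].
    by move: n_big h1 h2 h3 h4; clear; lia.
  by move: n_big h1 h3 h4; clear; lia.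
exists A1, B1; split.
- split=> // [||v /nbr_B0 h|v /nbr_A0 h].
  + by move: n_big cAB sizes cA0 cB0 cA1 cB1 c1; clear; lia.
  + by move: n_big cAB sizes cA0 cB0 cA1 cB1 c1; clear; lia.
  + by apply: leq_trans h _; rewrite leq_mul2l loB orbT.
  + by apply: leq_trans h _; rewrite leq_mul2l loA orbT.
- rewrite (leq_trans _ cbA) // subset_leq_card //; apply/subsetP => z.
  rewrite in_setD => /andP[zA1 zA]; apply: contraR zA1 => zb.
  by apply: (subsetP A01); rewrite in_setD zb.
- rewrite (leq_trans _ cbB) // subset_leq_card //; apply/subsetP => z.
  rewrite in_setD => /andP[zB1 zB]; apply: contraR zB1 => zb.
  by apply: (subsetP B01); rewrite in_setD zb.
- by rewrite (leq_trans _ cL0) // subset_leq_card // setCS setUSS.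
move=> v; rewrite !inE negb_or !negb_and -!leqNgt -!ltnNge.
case/andP=> /orP[//|h1] /orP[//|h2].
by move: h1 h2; clear; lia.
Qed.

End Coarse.

(** * Test vectors for the subharmonic inequality *)

Section Numeric.
Variable R : realFieldType.
Implicit Types a b l lam N X Y S : R.

(** [XA] and [XB] are the sums of the weights over the two sides of the cut, [XA1]
    and [XB1] those over the parts made from them, and [SA] the weighted number of
    cross edges. *)
Lemma coarse_bounds N a b lam XA XB XA1 XB1 SA :
  1000 * 1000 <= N -> a + b = N -> lam <= XB -> 0 < lam ->
  lam ^+ 2 <= SA + 5 * N -> SA <= b * XA -> XA <= XA1 + 500 -> XB <= XB1 + 500 ->
  1000 * b <= 502 * N + 1000 * 500 ->
  XA <= a -> N ^+ 2 <= 4 * lam ^+ 2 -> N <= 2 * lam -> 0 <= b -> 0 <= XA ->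
  [/\ 496 * N <= 1000 * XA1, 499 * N <= 1000 * XB1 & 1000 * lam <= 502 * N].
Proof.
move=> N_big cAB lamXB lam0 lamSA SA_X XA_A1 XB_B1 bB XA_a nlam2 nlam b0 XA0.
have N2 : 1000 * 1000 * N <= N ^+ 2.
  by rewrite expr2 ler_wpM2r //; move: N_big; clear; lra.
have le_ab : 4 * (b * a) <= N ^+ 2.
  by have := sqr_ge0 (a - b); rewrite -cAB; clear; lra.
split.
- rewrite leNgt; apply/negP => h.
  have : b * XA <= (502 / 1000 * N + 500) * (496 / 1000 * N + 500).
    by apply: ler_pM => //; [move: bB | move: h XA_A1]; clear; lra.
  by move: N_big N2 lamSA SA_X nlam2; clear; lra.
- by move: nlam lamXB XB_B1 N_big; clear; lra.
have le_bX : b * XA <= b * a by rewrite ler_wpM2l.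
suff : lam <= 502 / 1000 * N by clear; lra.
rewrite -ler_sqr ?nnegrE ?(ltW lam0) //; last by move: N_big; clear; lra.
by move: N_big N2 lamSA SA_X le_bX le_ab; clear; lra.
Qed.

(** Removing [l] vertices lowers [a b] by about [l N / 2], which earns about
    [0.249 l N^2] on the left, while [l] vertices of degree at most [0.45 N] and
    weight at most [9 / 10] contribute about [0.203 l N^2]. *)
Lemma low_degree_bounds N a b l lam X SA SB SL :
  1000 * 1000 <= N -> N ^+ 2 <= 4 * lam ^+ 2 -> N <= 2 * lam ->
  1000 * b <= 502 * N -> 1000 * lam <= 502 * N -> 499 * N <= 1000 * X ->
  a + b + l = N -> 1 <= l -> l <= 1000 ->
  SA <= 4 * b -> SB <= 4 * lam ->
  SL <= l * (9 / 10 * (502 / 1000 * N * (45 / 100 * N))) ->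
  (lam ^+ 2 - a * b) * X <= SA + SB + SL -> False.
Proof.
move=> N_big nlam2 nlam b_hi lam_hi XB cABL l_lo l_hi SA_le SB_le SL_le est.
have ab4 : 4 * (a * b) <= (N - l) ^+ 2.
  have := sqr_ge0 (a - b); rewrite -cABL; clear; lra.
have gap : l * (N / 2 - 250) <= lam ^+ 2 - a * b.
  have : l * l <= 1000 * l by rewrite ler_wpM2r //; move: l_lo; clear; lra.
  by move: nlam2 ab4; clear; lra.
have gap0 : 0 <= l * (N / 2 - 250) by rewrite mulr_ge0 //; move: N_big l_lo; clear; lra.
have h1 : l * (N / 2 - 250) * (499 / 1000 * N) <= (lam ^+ 2 - a * b) * X.
  by apply: ler_pM => //; move: N_big XB; clear; lra.
have h2 : 0 < N * (l * (4 / 100 * N - 250) - 8).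
  apply: mulr_gt0; first by move: N_big; clear; lra.
  have : 4 / 100 * N - 250 <= l * (4 / 100 * N - 250).
    by rewrite ler_peMl //; move: N_big; clear; lra.
  by move: N_big; clear; lra.
have h3 : 0 <= N * l by rewrite mulr_ge0 //; move: N_big l_lo; clear; lra.
have h4 : 0 <= N * l * N by rewrite mulr_ge0 //; move: N_big; clear; lra.
by move: h1 h2 h3 h4 est SA_le SB_le SL_le b_hi lam_hi N_big; clear; lra.
Qed.

End Numeric.

Section Weights.
Context {R : realType} {T : finType} (G : sgraph T).
Implicit Types (A B C S X Y : {set T}) (u v w z : T) (x y : T -> R).
Local Notation n := #|T|.
Local Notation N := (nbr G).

Definition subharmonic (lam : R) x := forall v, lam * x v <= \sum_(w in N v) x w.

Lemma subharmonic_sum lam x S : subharmonic lam x ->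
  lam * \sum_(v in S) x v <= \sum_w x w * #|N w :&: S|%:R.
Proof.
move=> sub; rewrite mulr_sumr; apply: le_trans (ler_sum _ (fun v _ => sub v)) _.
rewrite le_eqVlt; apply/orP; left; apply/eqP.
rewrite (exchange_big_dep predT) //=; apply: eq_bigr => w _.
rewrite mulr_natr -sumr_const; apply: eq_bigl => v.
by rewrite in_setI nbr_sym andbC.
Qed.

Lemma subharmonic_nbr lam x : 0 <= lam -> subharmonic lam x ->
  subharmonic lam (fun v => \sum_(w in N v) x w).
Proof.
move=> lam0 sub v; rewrite mulr_sumr.
by apply: ler_sum => w _; exact: sub.
Qed.

Lemma sum_setC A B (F : T -> R) : ~: A = B ->
  \sum_w F w = \sum_(w in A) F w + \sum_(w in B) F w.
Proof.
move=> <-; rewrite (bigID (mem A)) /=; congr (_ + _).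
by apply: eq_bigl => w; rewrite inE.
Qed.

Lemma sum_setUC A B (F : T -> R) : [disjoint A & B] ->
  \sum_w F w = \sum_(w in A) F w + \sum_(w in B) F w + \sum_(w in ~: (A :|: B)) F w.
Proof.
move=> dis; rewrite (sum_setC (A :|: B) _ _ erefl); congr (_ + _).
rewrite -bigU //=; apply: eq_bigl => w; by rewrite !inE.
Qed.

(** The subharmonic inequality tested against [#|B|] on [A] and [lam] on [B]. With
    these weights the terms of a complete bipartite graph cancel, except for
    [lam^2 - #|A| #|B|] on [B], and only the deviations from it remain. *)
Lemma bipartite_estimate lam x A B : [disjoint A & B] -> subharmonic lam x ->
  0 <= lam ->
  (lam ^+ 2 - #|A|%:R * #|B|%:R) * \sum_(w in B) x w <=
    \sum_(w in A) x w * (#|B|%:R * #|N w :&: A|%:R - lam * #|B :\: N w|%:R)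
  + \sum_(w in B) x w * (lam * #|N w :&: B|%:R - #|B|%:R * #|A :\: N w|%:R)
  + \sum_(w in ~: (A :|: B)) x w * (#|B|%:R * #|N w :&: A|%:R + lam * #|N w :&: B|%:R).
Proof.
move=> dis sub lam0.
have cE X w : #|N w :&: X|%:R = #|X|%:R - #|X :\: N w|%:R :> R.
  by rewrite -(cardsID (N w) X) natrD addrK setIC.
have hA := subharmonic_sum lam x A sub; have hB := subharmonic_sum lam x B sub.
have hs : #|B|%:R * (lam * \sum_(v in A) x v) + lam * (lam * \sum_(v in B) x v) <=
  \sum_w x w * (#|B|%:R * #|N w :&: A|%:R + lam * #|N w :&: B|%:R).
  under [leRHS]eq_bigr => w _ do rewrite mulrDr mulrCA [x w * (lam * _)]mulrCA.
  by rewrite big_split -!mulr_sumr lerD // ler_wpM2l.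
rewrite (sum_setUC A B) // in hs; set L := \sum_(w in ~: _) _ in hs *.
have eA : \sum_(w in A) x w * (#|B|%:R * #|N w :&: A|%:R + lam * #|N w :&: B|%:R) =
  lam * #|B|%:R * \sum_(w in A) x w +
  \sum_(w in A) x w * (#|B|%:R * #|N w :&: A|%:R - lam * #|B :\: N w|%:R).
  rewrite mulr_sumr -big_split /=; apply: eq_bigr => w _; rewrite (cE B); ring.
have eB : \sum_(w in B) x w * (#|B|%:R * #|N w :&: A|%:R + lam * #|N w :&: B|%:R) =
  #|A|%:R * #|B|%:R * \sum_(w in B) x w +
  \sum_(w in B) x w * (lam * #|N w :&: B|%:R - #|B|%:R * #|A :\: N w|%:R).
  rewrite mulr_sumr -big_split /=; apply: eq_bigr => w _; rewrite (cE A); ring.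
rewrite eA eB in hs; move: hs; set SA := \sum_(w in A) x w * _.
set SB := \sum_(w in B) x w * _; set XA := \sum_(w in A) x w; set XB := \sum_(w in B) x w.
lra.
Qed.

Lemma sum_weight_le A (x f g : T -> R) (lo hi : R) :
  (forall w, w \in A -> lo <= x w <= hi) -> (forall w, 0 <= f w) -> (forall w, 0 <= g w) ->
  \sum_(w in A) x w * (f w - g w) <= hi * \sum_(w in A) f w - lo * \sum_(w in A) g w.
Proof.
move=> lohi f0 g0; rewrite !mulr_sumr -sumrB; apply: ler_sum => w wA.
have /andP[l h] := lohi w wA.
by rewrite mulrBr lerB // ler_wpM2r.
Qed.

End Weights.

(** * The structure of G *)

Section Main.
Context {R : realType} {T : finType} (G : sgraph T) (lam : R).
Implicit Types (A B C S X Y : {set T}) (u v w z : T) (x y : T -> R).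
Local Notation n := #|T|.
Local Notation N := (nbr G).
Hypothesis n_big : (88 * 10 ^ 5 <= n)%N.
Hypothesis few : (2 * bowties G <= n)%N.
Hypothesis lam_gt0 : 0 < lam.
Hypothesis lam_sq : (uphalf n * n./2)%:R + 4 <= lam ^+ 2.

Let n_bigR : 1000 * 1000 <= n%:R :> R.
Proof. by rewrite -natrM ler_nat; lia. Qed.

Lemma sqr_le_half_prod : (n * n <= 4 * (uphalf n * n./2) + 1)%N.
Proof.
rewrite uphalf_half -{1 2}(odd_double_half n) -mul2n.
case: odd; move: (n./2) => h /=; clear; nia.
Qed.

Lemma lam_lower : n%:R ^+ 2 <= 4 * lam ^+ 2 /\ n%:R <= 2 * lam.
Proof.
have h : n%:R ^+ 2 <= 4 * lam ^+ 2.
  have : (n * n)%:R <= (4 * (uphalf n * n./2) + 1)%:R :> R by rewrite ler_nat sqr_le_half_prod.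
  rewrite natrD (natrM _ 4) (natrM _ n) -expr2; move: lam_sq; set m := (_ * _)%:R; set s := n%:R ^+ 2; lra.
split=> //; rewrite -ler_sqr ?nnegrE ?mulr_ge0 //; last exact: ltW.
have -> : (2 * lam) ^+ 2 = 4 * lam ^+ 2 by rewrite exprMn expr2 -natrM.
by []. 
Qed.

(** The cut is the neighbourhood of a vertex [u] of largest weight against its
    complement. *)
Lemma coarse_structure x : (forall v, 0 <= x v) -> (exists v, 0 < x v) -> subharmonic G lam x ->
  exists x A B, [/\ forall v, 0 <= x v <= 1, subharmonic G lam x, near_bip G A B &
   [/\ (#|~: (A :|: B)| <= 1000)%N,
    forall v, v \in ~: (A :|: B) -> (100 * #|N v| <= 45 * n)%N,
    496 * n%:R <= 1000 * \sum_(w in A) x w,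
    499 * n%:R <= 1000 * \sum_(w in B) x w & 1000 * lam <= 502 * n%:R]].
Proof.
move=> x0 [v0 xv0] sub.
have [u maxu] : exists u, forall v, x v <= x u.
  pose u := [arg max_(i > v0) x i]%O; exists u => v.
  by rewrite /u; case: arg_maxP => // i _; apply.
have xu0 : 0 < x u by exact: lt_le_trans (maxu v0).
pose x1 v := x v / x u.
have x1_01 v : 0 <= x1 v <= 1.
  by rewrite /x1 divr_ge0 ?(ltW xu0) //= ler_pdivrMr // mul1r.
have x1u : x1 u = 1 by rewrite /x1 divff // gt_eqF.
have sub1 : subharmonic G lam x1.
  by move=> v; rewrite /x1 mulrA -mulr_suml ler_pM2r ?invr_gt0.
move: x1 x1_01 x1u sub1 => {x0 xv0 sub maxu xu0}x x01 xu sub; clear v0.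
have [nlam2 nlam] := lam_lower.
pose B := N u; pose A := ~: B.
have AB : ~: A = B by rewrite setCK.
have cAB : #|A|%:R + #|B|%:R = n%:R :> R by rewrite -natrD addnC cardsC.
have x_ge0 v : 0 <= x v by case/andP: (x01 v).
have x_le1 v : x v <= 1 by case/andP: (x01 v).
have lamXB : lam <= \sum_(w in B) x w by have := sub u; rewrite xu mulr1.
have lam0 := ltW lam_gt0.
have main := subharmonic_sum G lam x B sub.
rewrite (sum_setC A B) // in main.
have inB : \sum_(w in B) x w * #|N w :&: B|%:R <= 5 * n%:R.
  apply: le_trans (_ : (\sum_(w in B) #|N w :&: B|)%:R <= _).
    by rewrite natr_sum; apply: ler_sum => w _; rewrite ler_piMl.
  rewrite -natrM ler_nat; have := sum_link_degree G u; rewrite -/B; move: few; clear; lia.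
set SA := \sum_(w in A) _ in main.
have lamSA : lam ^+ 2 <= SA + 5 * n%:R.
  apply: le_trans (_ : lam * \sum_(w in B) x w <= _); first by rewrite expr2 ler_wpM2l.
  by apply: le_trans main _; rewrite lerD2l.
have SA_E : SA <= (\sum_(w in A) #|N w :&: B|)%:R.
  by rewrite natr_sum; apply: ler_sum => w _; rewrite ler_piMl.
have SA_X : SA <= #|B|%:R * \sum_(w in A) x w.
  rewrite mulr_sumr; apply: ler_sum => w _; rewrite mulrC ler_wpM2r // ler_nat.
  by rewrite subset_leq_card // subsetIr.
have leE : (n * n <= 4 * (\sum_(w in A) #|N w :&: B|) + 20 * n)%N.
  rewrite -(ler_nat R) natrD !natrM -expr2; lra.
have [A1 [B1 [nb cA cB cL degL]]] := almost_bipartite G n_big few A B AB leE.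
exists x, A1, B1; split=> //.
have restrict (X Y : {set T}) : (#|X :\: Y| <= 500)%N ->
    \sum_(w in X) x w <= \sum_(w in Y) x w + 500.
  move=> cXY; rewrite (big_setID Y) /= lerD //.
    rewrite [leRHS](big_setID X) /= setIC lerDl; exact: sumr_ge0.
  apply: le_trans (_ : \sum_(w in X :\: Y) 1 <= _); first exact: ler_sum.
  by rewrite sumr_const (ler_nat R _ 500).
have XA_A1 := restrict _ _ cA; have XB_B1 := restrict _ _ cB.
have bB : 1000 * #|B|%:R <= 502 * n%:R + 1000 * 500 :> R.
  have := nb_B _ _ _ nb; have := subset_leq_card (subsetIr B B1).
  have := cardsID B1 B => e1 e2 e3.
  by rewrite -!natrM -natrD ler_nat; move: e1 e2 e3 cB; clear; lia.
have XA_a : \sum_(w in A) x w <= #|A|%:R.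
  by rewrite -sumr_const; exact: ler_sum.
have b0 : 0 <= #|B|%:R :> R by [].
have XA0 : 0 <= \sum_(w in A) x w by exact: sumr_ge0.
have [hA hB hlam] := coarse_bounds _ _ _ _ _ _ _ _ _ _ n_bigR cAB lamXB lam_gt0
  lamSA SA_X XA_A1 XB_B1 bB XA_a nlam2 nlam b0 XA0.
by split=> //; split.
Qed.

Lemma inner_le4 A B : near_bip G A B -> (inner G A <= 4)%N.
Proof.
by move=> AB; case: (inner_edges G n_big few AB) => [/leq_trans->//|[]].
Qed.

(** A vertex of degree at most [0.45 n] has weight at most [9 / 10], because
    [lam >= n / 2], and so contributes less than its absence from the parts costs in
    [#|A| * #|B|]. *)
Lemma no_low_degree x A B : (forall v, 0 <= x v <= 1) -> subharmonic G lam x ->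
  near_bip G A B -> (#|~: (A :|: B)| <= 1000)%N ->
  (forall v, v \in ~: (A :|: B) -> (100 * #|N v| <= 45 * n)%N) ->
  499 * n%:R <= 1000 * \sum_(w in B) x w -> 1000 * lam <= 502 * n%:R ->
  ~: (A :|: B) = set0.
Proof.
move=> x01 sub AB; set L := ~: (A :|: B) => cL degL XB lam_hi.
apply/eqP; rewrite -cards_eq0; apply/negPn/negP; rewrite -lt0n => L0.
have [nlam2 nlam] := lam_lower.
have lam0 := ltW lam_gt0.
have x_le1 v : x v <= 1 by case/andP: (x01 v).
have est := bipartite_estimate G lam x A B (nb_dis _ _ _ AB) sub lam0.
rewrite -/L in est.
have b_hi : 1000 * #|B|%:R <= 502 * n%:R :> R.
  by rewrite -!natrM ler_nat; case/andP: (nb_B _ _ _ AB).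
have cABL : #|A|%:R + #|B|%:R + #|L|%:R = n%:R :> R.
  rewrite -!natrD; congr _%:R; rewrite -(cardsC (A :|: B)) cardsU.
  by rewrite (disjoint_setI0 (nb_dis _ _ _ AB)) cards0 subn0.
have cLR : #|L|%:R <= 1000 :> R by rewrite (ler_nat R _ 1000).
have L0R : 1 <= #|L|%:R :> R by rewrite (ler_nat R 1).
set SA := \sum_(w in A) _ in est; set SB := \sum_(w in B) x w * _ in est.
set SL := \sum_(w in L) _ in est; set XB' := \sum_(w in B) x w in est XB.
have SA_le : SA <= 4 * #|B|%:R.
  apply: le_trans (sum_weight_le A _ _ _ 0 1 _ _ _) _ => [w _|w|w|]; rewrite ?mulr_ge0 //.
  rewrite mul0r subr0 mul1r -mulr_sumr -natr_sum mulrC ler_wpM2r //.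
  by rewrite (ler_nat R _ 4); exact: inner_le4 AB.
have SB_le : SB <= 4 * lam.
  apply: le_trans (sum_weight_le B _ _ _ 0 1 _ _ _) _ => [w _|w|w|]; rewrite ?mulr_ge0 //.
  rewrite mul0r subr0 mul1r -mulr_sumr -natr_sum mulrC ler_wpM2r //.
  by rewrite (ler_nat R _ 4); exact: inner_le4 (near_bip_sym _ _ _ AB).
have SL_le : SL <= #|L|%:R * (9 / 10 * (502 / 1000 * n%:R * (45 / 100 * n%:R))).
  rewrite mulr_natl -sumr_const; apply: ler_sum => w wL.
  have deg : #|N w|%:R <= 45 / 100 * n%:R :> R.
    have := degL w wL; rewrite -(ler_nat R) !natrM; lra.
  have xw : x w <= 9 / 10.
    have : lam * x w <= #|N w|%:R.
      by apply: le_trans (sub w) _; rewrite -sumr_const; exact: ler_sum.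
    have := x01 w; move: deg nlam n_bigR; clear; move: (n%:R) (#|_|%:R) => N' d.
    move=> h1 h2 h3 /andP[h4 _] h5; nra.
  have ddeg : #|N w :&: A|%:R + #|N w :&: B|%:R <= #|N w|%:R :> R.
    rewrite -natrD ler_nat -cardsUI setIACA (disjoint_setI0 (nb_dis _ _ _ AB)) setI0 cards0 addn0.
    by rewrite subset_leq_card // -setIUr subsetIl.
  have d0 : 0 <= #|N w :&: A|%:R :> R by [].
  have d0' : 0 <= #|N w :&: B|%:R :> R by [].
  apply: ler_pM => //; first by case/andP: (x01 w).
    by rewrite addr_ge0 ?mulr_ge0.
  apply: le_trans (_ : 502 / 1000 * n%:R * (#|N w :&: A|%:R + #|N w :&: B|%:R) <= _).
    rewrite mulrDr lerD // ler_wpM2r //; lra.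
  rewrite ler_wpM2l; lra.
exact: (low_degree_bounds _ _ _ _ _ _ _ _ _ _ n_bigR nlam2 nlam b_hi lam_hi XB cABL L0R cLR SA_le SB_le SL_le est).
Qed.

End Main.

(** The inequality of [bipartite_estimate] divided by [N^2 / 1000], for weights
    between [0.443 N] and [0.503 N]: [PA] and [PB] are twice the numbers of inner
    edges, [q] is the number of missing pairs and [k] the defect of [a b] from its
    maximum. *)
Lemma edge_balance (R : realFieldType) (N a b lam Y SA SB PA PB q M k : R) :
  1000 * 1000 <= N -> 498 * N <= 1000 * b -> 1000 * b <= 502 * N ->
  N <= 2 * lam -> 1000 * lam <= 502 * N -> 249 * N ^+ 2 <= 1000 * Y ->
  M + 4 <= lam ^+ 2 -> a * b + k <= M -> 0 <= k -> 0 <= PA -> 0 <= PB -> 0 <= q ->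
  SA <= 503 / 1000 * N * (b * PA) - 443 / 1000 * N * (lam * q) ->
  SB <= 503 / 1000 * N * (lam * PB) - 443 / 1000 * N * (b * q) ->
  (lam ^+ 2 - a * b) * Y <= SA + SB ->
  996 + 249 * k + 442 * q <= 253 * (PA + PB).
Proof.
move=> N_big b_lo b_hi lam_lo lam_hi Y_lo lamM abM k0 PA0 PB0 q0 SA_le SB_le est.
have N0 : 0 < N by move: N_big; clear; lra.
have N20 : 0 < N ^+ 2 by rewrite exprn_gt0.
have h1 : (4 + k) * (249 / 1000 * N ^+ 2) <= (lam ^+ 2 - a * b) * Y.
  apply: ler_pM; [move: k0|move: N20|move: lamM abM|move: Y_lo]; clear; lra.
have h2 : b * PA <= 502 / 1000 * N * PA by rewrite ler_wpM2r //; move: b_hi; clear; lra.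
have h3 : lam * PB <= 502 / 1000 * N * PB by rewrite ler_wpM2r //; move: lam_hi; clear; lra.
have h4 : 998 / 1000 * N * q <= (lam + b) * q.
  by rewrite ler_wpM2r //; move: lam_lo b_lo; clear; lra.
have h5 : N * (b * PA + lam * PB) <= N * (502 / 1000 * N * (PA + PB)).
  by rewrite ler_wpM2l ?(ltW N0) //; move: h2 h3; clear; lra.
have h6 : N * (998 / 1000 * N * q) <= N * ((lam + b) * q) by rewrite ler_wpM2l ?(ltW N0).
have key : 0 <= N ^+ 2 * (503 / 1000 * (502 / 1000) * (PA + PB) - 443 / 1000 * (998 / 1000) * q - (4 + k) * (249 / 1000)).
  by move: h1 h5 h6 est SA_le SB_le; clear; lra.
rewrite pmulr_rge0 // in key.
by move: key q0 PA0 PB0 k0; clear; lra.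
Qed.

Lemma half_square (R : realFieldType) (N a b : R) :
  1 / 2 * N * (499 / 1000 * N) <= a -> a <= b -> 249 * N ^+ 2 <= 1000 * b.
Proof. by have := sqr_ge0 N; lra. Qed.

Section Endgame.
Context {R : realType} {T : finType} (G : sgraph T) (lam : R).
Implicit Types (A B C S X Y : {set T}) (u v w z : T) (x y : T -> R).
Local Notation n := #|T|.
Local Notation N := (nbr G).
Hypothesis n_big : (88 * 10 ^ 5 <= n)%N.
Hypothesis few : (2 * bowties G <= n)%N.
Hypothesis lam_gt0 : 0 < lam.
Hypothesis lam_sq : (uphalf n * n./2)%:R + 4 <= lam ^+ 2.

Lemma card_missing A B : #|missing G A B| = (\sum_(v in A) #|B :\: N v|)%N.
Proof.
rewrite -sum1_card /missing.
under [RHS]eq_bigr => v _ do rewrite -sum1_card.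
rewrite pair_big_dep /=; apply: eq_bigl => -[v w].
by rewrite !inE /= -andbA [in RHS]andbCA andbA andbC.
Qed.

Lemma sum_nonnbr_sym A B :
  (\sum_(v in A) #|B :\: N v| = \sum_(v in B) #|A :\: N v|)%N.
Proof.
apply/eqP; rewrite -(eqn_add2r (\sum_(v in A) #|N v :&: B|)%N) sum_card_nonnbr.
by rewrite sum_card_nbr sum_card_nonnbr mulnC.
Qed.

(** The weights can vanish at individual vertices, but their sums over
    neighbourhoods cannot: a vertex of [A] sees [0.449 n] vertices of [B], on which
    the total deficit of the weights from 1 is small. *)
Lemma nbr_sum_bounds x A B v : (forall v, 0 <= x v <= 1) -> near_bip G A B ->
  ~: (A :|: B) = set0 -> 496 * n%:R <= 1000 * \sum_(w in B) x w -> v \in A ->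
  443 / 1000 * n%:R <= \sum_(w in N v) x w <= 503 / 1000 * n%:R.
Proof.
move=> x01 AB L0 XB vA.
have x_ge0 w : 0 <= x w by case/andP: (x01 w).
have x_le1 w : x w <= 1 by case/andP: (x01 w).
have degE : #|N v| = (#|N v :&: A| + #|N v :&: B|)%N.
  rewrite -cardsUI setIACA (disjoint_setI0 (nb_dis _ _ _ AB)) setI0 cards0 addn0.
  by rewrite -setIUr -[A :|: B]setCK L0 setC0 setIT.
have n_bigR : 1000 * 1000 <= n%:R :> R by rewrite -natrM ler_nat; move: n_big; clear; lia.
apply/andP; split.
  apply: le_trans (_ : \sum_(w in N v :&: B) x w <= _); last first.
    by rewrite [leRHS](big_setID B) /= lerDl sumr_ge0.
  have e : \sum_(w in B) x w = \sum_(w in N v :&: B) x w + \sum_(w in B :\: N v) x w.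
    by rewrite (big_setID (N v)) setIC.
  have le : \sum_(w in B :\: N v) x w <= #|B :\: N v|%:R.
    by rewrite -sumr_const; exact: ler_sum.
  have cE : #|N v :&: B|%:R + #|B :\: N v|%:R = #|B|%:R :> R.
    by rewrite -natrD setIC cardsID.
  have b_hi : 1000 * #|B|%:R <= 502 * n%:R :> R.
    by rewrite -!natrM ler_nat; case/andP: (nb_B _ _ _ AB).
  have d_lo : 449 * n%:R <= 1000 * #|N v :&: B|%:R :> R.
    by rewrite -!natrM ler_nat; exact: (nb_AB _ _ _ AB _ vA).
  rewrite e in XB; lra.
apply: le_trans (_ : #|N v|%:R <= _).
  by rewrite -sumr_const; exact: ler_sum.
have : (1000 * #|N v| <= 502 * n + 1000)%N.
  have := inner_deg G n_big few AB v vA; have := subset_leq_card (subsetIr (N v) B).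
  have /andP[_] := nb_B _ _ _ AB; rewrite degE; clear; lia.
rewrite -(ler_nat R) natrD !natrM; lra.
Qed.

(** By [edge_balance], [996 + 249 k + 442 q <= 253 P], where [P] is twice the number
    of inner edges. As each side contributes at most 4 to [P], [missing_ge2] and [missing_ge4]
    exclude inner edges on both sides. This leaves [P <= 4], hence [P = 4] and
    [q = k = 0]. *)
Lemma extremal_structure x : (forall v, 0 <= x v) -> (exists v, 0 < x v) ->
  subharmonic G lam x ->
  exists A B, [/\ ~: A = B, near_bip G A B & [/\ (2 < inner G A)%N,
    inner G B = 0%N, (\sum_(v in A) #|B :\: N v| = 0)%N &
    (uphalf n * n./2 <= #|A| * #|B|)%N]].
Proof.
move=> x0 xpos sub0.
have [{x0 xpos sub0}x [A [B [x01 sub AB [cL degL XA XB lam_hi]]]]] :=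
  coarse_structure G lam n_big few lam_gt0 lam_sq x x0 xpos sub0.
have L0 := no_low_degree G lam n_big few lam_gt0 lam_sq x A B x01 sub AB cL degL XB lam_hi.
have [_ nlam] := lam_lower lam lam_gt0 lam_sq.
have lam0 := ltW lam_gt0.
pose BA := near_bip_sym _ _ _ AB.
have L0' : ~: (B :|: A) = set0 by rewrite setUC.
have AcB : ~: A = B.
  apply/eqP; rewrite eqEsubset -[X in _ && X]disjoints_subset disjoint_sym (nb_dis _ _ _ AB) andbT.
  by rewrite -setD_eq0 setDE -setCU setUC [_ :|: A]setUC L0.
have n_bigR : 1000 * 1000 <= n%:R :> R by rewrite -natrM ler_nat; move: n_big; clear; lia.
(* Unlike [x], the vector [y] is bounded below at every vertex, which the loss from
   the missing pairs needs. *)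
pose y v := \sum_(w in N v) x w.
have suby : subharmonic G lam y by exact: subharmonic_nbr.
have yA v : v \in A -> 443 / 1000 * n%:R <= y v <= 503 / 1000 * n%:R.
  by move=> vA; apply: (nbr_sum_bounds x A B v x01 AB L0) => //; lra.
have yB v : v \in B -> 443 / 1000 * n%:R <= y v <= 503 / 1000 * n%:R.
  by move=> vB; apply: (nbr_sum_bounds x B A v x01 BA L0') => //; lra.
have YB : 249 * n%:R ^+ 2 <= 1000 * \sum_(w in B) y w.
  have : lam * \sum_(w in B) x w <= \sum_(w in B) y w by rewrite mulr_sumr ler_sum.
  have : 1 / 2 * n%:R * (499 / 1000 * n%:R) <= lam * \sum_(w in B) x w.
    by apply: ler_pM; lra.
  exact: half_square.
have est := bipartite_estimate G lam y A B (nb_dis _ _ _ AB) suby lam0.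
rewrite L0 big_set0 addr0 in est.
set q := (\sum_(v in A) #|B :\: N v|)%N.
have SA := sum_weight_le A y (fun w => #|B|%:R * #|N w :&: A|%:R) (fun w => lam * #|B :\: N w|%:R) _ _ yA.
have SB := sum_weight_le B y (fun w => lam * #|N w :&: B|%:R) (fun w => #|B|%:R * #|A :\: N w|%:R) _ _ yB.
rewrite -!mulr_sumr -!natr_sum -/q in SA.
rewrite -!mulr_sumr -!natr_sum -sum_nonnbr_sym -/q in SB.
have {}SA := SA (fun w => mulr_ge0 (ler0n _ _) (ler0n _ _)) (fun w => mulr_ge0 lam0 (ler0n _ _)).
have {}SB := SB (fun w => mulr_ge0 lam0 (ler0n _ _)) (fun w => mulr_ge0 (ler0n _ _) (ler0n _ _)).
have b_lohi := nb_B _ _ _ AB.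
have b_lo : 498 * n%:R <= 1000 * #|B|%:R :> R by rewrite -!natrM ler_nat; case/andP: b_lohi.
have b_hi : 1000 * #|B|%:R <= 502 * n%:R :> R by rewrite -!natrM ler_nat; case/andP: b_lohi.
have balance (k : nat) : (#|A| * #|B| + k <= uphalf n * n./2)%N ->
    (996 + 249 * k + 442 * q <= 253 * (inner G A + inner G B))%N.
  move=> abM; rewrite -(ler_nat R) (natrD _ (996 + 249 * k)) (natrD _ 996) (natrM _ 249) (natrM _ 442) (natrM _ 253) (natrD _ (inner G A)).
  apply: (edge_balance _ _ _ _ _ _ _ _ _ _ _ _ _ n_bigR b_lo b_hi nlam lam_hi YB lam_sq _ _ _ _ _ SA SB est) => //.
  by rewrite -natrM -natrD ler_nat.
have cAB : (#|A| + #|B| = n)%N by rewrite -AcB cardsC.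
have abM : (#|A| * #|B| <= uphalf n * n./2)%N.
  have := (nat_AGM2 #|A| #|B|).1; rewrite cAB -mulnn; have := sqr_le_half_prod (T := T).
  move: (#|A| * #|B|)%N (uphalf n * n./2)%N (n * n)%N; clear; lia.
have qA : (0 < inner G A)%N -> (0 < inner G B)%N -> (2 <= q)%N.
  by move=> hA hB; rewrite /q -card_missing; exact: missing_ge2.
have qA4 : (2 < inner G A)%N -> (0 < inner G B)%N -> (4 <= q)%N.
  by move=> hA hB; rewrite /q -card_missing; exact: missing_ge4.
have qB4 : (2 < inner G B)%N -> (0 < inner G A)%N -> (4 <= q)%N.
  by move=> hB hA; rewrite /q sum_nonnbr_sym -card_missing; exact: missing_ge4.
have PA4 := inner_le4 G n_big few A B AB; have PB4 := inner_le4 G n_big few B A BA.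
have bal0 := balance 0%N; rewrite addn0 in bal0; have {}bal0 := bal0 abM.
have abM' : (uphalf n * n./2 <= #|A| * #|B|)%N.
  rewrite leqNgt -addn1; apply/negP => /balance.
  move: qA qA4 qB4 PA4 PB4 bal0; clear; lia.
have : (2 < inner G A)%N /\ inner G B = 0%N /\ q = 0%N \/
       (2 < inner G B)%N /\ inner G A = 0%N /\ q = 0%N.
  move: qA qA4 qB4 PA4 PB4 bal0; clear; lia.
case=> [[h1 [h2 h3]]|[h1 [h2 h3]]]; first by exists A, B.
exists B, A; split=> //; first by rewrite -AcB setCK.
by split=> //; [rewrite -sum_nonnbr_sym | rewrite (mulnC #|B|)].
Qed.

End Endgame.

(** * The extremal graph *)

Lemma max_product_parts (a b n : nat) : (a + b = n)%N -> (b <= n./2)%N ->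
  (uphalf n * n./2 <= a * b)%N -> a = uphalf n /\ b = n./2.
Proof.
move=> ab bh prod; have := uphalf_half n; have := odd_double_half n.
rewrite -addnn; case: (odd n) => /= nE uE.
  move: bh; rewrite leq_eqVlt => /orP[/eqP|] bh; first by lia.
  exfalso; move: prod; rewrite uE.
  have [e [eb e0]] : exists e, n./2 = (b + e)%N /\ (0 < e)%N by exists (n./2 - b)%N; lia.
  have ae : a = (1 + n./2 + e)%N by lia.
  rewrite ae eb; apply/negP; rewrite -ltnNge; clear -e0; nia.
move: bh; rewrite leq_eqVlt => /orP[/eqP|] bh; first by lia.
exfalso; move: prod; rewrite uE.
have [e [eb e0]] : exists e, n./2 = (b + e)%N /\ (0 < e)%N by exists (n./2 - b)%N; lia.
have ae : a = (n./2 + e)%N by lia.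
rewrite ae eb; apply/negP; rewrite -ltnNge; clear -e0; nia.
Qed.

Lemma few_bowties_extremal (R : realType) (T : finType) (G : sgraph T) :
  (88 * 10 ^ 5 <= #|T|)%N ->
  spectral_radius R (Kplus2 (uphalf #|T|) #|T|./2) <= spectral_radius R G ->
  (bowties G <= #|T|./2)%N ->
  isomorphic G (Kplus2 (uphalf #|T|) #|T|./2).
Proof.
move=> n_big hG le_half.
have halves := odd_double_half #|T|.
have few : (2 * bowties G <= #|T|)%N by rewrite -halves -mul2n; move: le_half; clear; lia.
have [K0 Ksq] : 0 < spectral_radius R (Kplus2 (uphalf #|T|) #|T|./2) /\
    (uphalf #|T| * #|T|./2)%:R + 4 <= spectral_radius R (Kplus2 (uphalf #|T|) #|T|./2) ^+ 2.
  by apply: Kplus2_radius; rewrite ?uphalf_half; move: n_big halves; rewrite -mul2n; clear; lia.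
have lam0 := lt_le_trans K0 hG.
have lam_sq : (uphalf #|T| * #|T|./2)%:R + 4 <= spectral_radius R G ^+ 2.
  by apply: le_trans Ksq _; rewrite ler_sqr ?nnegrE ?(ltW K0) ?(ltW lam0).
have [x [x0 xpos sub]] := spectral_radius_subharmonic G lam0.
have [A [B [AcB AB [PA PB q0 prod]]]] :=
  extremal_structure G _ n_big few lam0 lam_sq x x0 xpos sub.
have [|[_ [v1 [w1 [v2 [w2 [sub4 un e1 e2 adjA]]]]]]] := inner_edges G n_big few AB.
  by rewrite leqNgt PA.
have iso : isomorphic G (Kplus2 #|A| #|B|).
  apply: (isomorphic_Kplus2 _ G A B v1 w1 v2 w2) => // [v w vA wB|v w vB wB].
    move/eqP: q0; rewrite sum_nat_eq0 => /forallP/(_ v); rewrite vA /= cards_eq0.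
    by move/eqP/setP/(_ w); rewrite !inE wB andbT => /negbFE.
  move/eqP: PB; rewrite sum_nat_eq0 => /forallP/(_ v); rewrite vB /= cards_eq0.
  by move/eqP/setP/(_ w); rewrite !inE wB andbT => ->.
have A4 : (4 <= #|A|)%N.
  by case: AB => _ + _ _ _; move: n_big; clear; lia.
have bB : bowties G = #|B| by rewrite /bowties (count_copies_iso _ _ _ _ _ _ iso); exact: bowties_Kplus2.
have cAB : (#|A| + #|B| = #|T|)%N by rewrite -AcB cardsC.
rewrite bB in le_half.
by have [<- <-] := max_product_parts _ _ _ cAB le_half prod.
Qed.

Theorem theorem2p4 (R : realType) (n : nat) (hn : (88 * 10 ^ 5 <= n)%N)
  (T : finType) (G : sgraph T) (hT : #|T| = n)
  (hG : spectral_radius R (Kplus2 (uphalf n) n./2) <= spectral_radius R G) :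
  (n./2 <= bowties G)%N /\
  (bowties G = n./2 <-> isomorphic G (Kplus2 (uphalf n) n./2)).
Proof.
subst n.
have iso_count : isomorphic G (Kplus2 (uphalf #|T|) #|T|./2) -> bowties G = #|T|./2.
  move=> iso; rewrite /bowties (count_copies_iso _ _ _ _ _ _ iso); apply: bowties_Kplus2.
  by rewrite uphalf_half; have := odd_double_half #|T|; rewrite -mul2n; move: hn; clear; lia.
split.
  rewrite leqNgt; apply/negP => lt.
  by move: (lt); rewrite (iso_count (few_bowties_extremal _ _ _ hn hG (ltnW lt))) ltnn.
split=> [E|//]; apply: few_bowties_extremal hn hG _.
by rewrite E.
Qed.
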